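(* Let $f:[0,1]\to\mathbb{R}$ be a function, let $y\in[0,1)$, let $N\ge 0$ be the largest integer for which the $N$-th derivative of $f$ at $y$ exists and is finite, and let $N<q\le N+1$. Suppose that the local fractional derivative $\mathbb{D}^q f(y)$ exists. Then for $x\in(y,1]$, $$f(x)=\sum_{n=0}^{N}\frac{f^{(n)}(y)}{\Gamma(n+1)}(x-y)^n+\frac{\mathbb{D}^q f(y)}{\Gamma(q+1)}(x-y)^q+R_q(x,y),$$ where $$R_q(x,y)=\frac{1}{\Gamma(q+1)}\int_0^{x-y}\frac{dF(y,t;q,N)}{dt}\,(x-y-t)^q\,dt,$$ provided this last term exists.
   Context: Riemann–Liouville fractional derivative: for $n-1<q<n$ ($n$ a positive integer) and $x>a$, $$\frac{d^q g(x)}{[d(x-a)]^q}=\frac{1}{\Gamma(n-q)}\frac{d^n}{dx^n}\int_a^x\frac{g(u)}{(x-u)^{q-n+1}}\,du,$$ and for $q=n$ it is the ordinary $n$-th derivative. Notation: for $t>0$, $F(y,t;q,N)$ denotes the Riemann–Liouville derivative of order $q$ with lower limit $a=y$, evaluated at $x=y+t$, of the function $x\mapsto f(x)-\sum_{n=0}^{N}\frac{f^{(n)}(y)}{\Gamma(n+1)}(x-y)^n$. Local fractional derivative: $\mathbb{D}^q f(y)=\lim_{t\to0^+}F(y,t;q,N)$, said to exist if this limit exists and is finite; $F(y,0;q,N)$ is set equal to $\mathbb{D}^q f(y)$.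
   Formalization: Added, since the claim fails for arbitrary f: f is right-continuous at y and left-continuous at the x considered. ''This last term exists'' is taken to mean that F is differentiable in t at every t in (0,x-y) and the integrand of R_q is Lebesgue integrable there. *)

(* Defs.v *)
From mathcomp Require Export all_boot all_order all_algebra.
From mathcomp Require Export all_classical all_reals all_analysis.
Export Order.TTheory GRing.Theory Num.Theory.
Export numFieldNormedType.Exports.

Set Implicit Arguments.
Unset Strict Implicit.
Unset Printing Implicit Defensive.

Local Open Scope classical_set_scope.
Local Open Scope ring_scope.

(* Functions with domain [D] are represented by total functions [f : R -> R];
   the notions relative to [D] below depend only on the values of [f] on [D].
   At an interior point of [D] the derivative is the usual two-sided one, at an
   endpoint it is one-sided. *)

Definition derive_within {R : realType} (D : set R) (f : R -> R) (x : R) : R :=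
  lim ((f z - f x) / (z - x) @[z --> within D x^']).

Definition derivable_within {R : realType} (D : set R) (f : R -> R) (x : R) :=
  cvg ((f z - f x) / (z - x) @[z --> within D x^']).

Definition nderive_within {R : realType} (D : set R) (n : nat) (f : R -> R) :
  R -> R := iter n (derive_within D) f.

(* [nderive_within D n f x] is meaningful: the derivatives of order [< n] exist
   at all points of [D] near [x], and the last one is derivable at [x]. *)
Fixpoint nderivable_within {R : realType} (D : set R) (n : nat) (f : R -> R)
    (x : R) : Prop :=
  if n is m.+1 then
    (\forall z \near within D (nbhs x), nderivable_within D m f z) /\
    derivable_within D (nderive_within D m f) x
  else True.

(* The ordinary (two-sided) derivative [derive1n n f] exists at [x]. *)
Fixpoint nderivable {R : realType} (n : nat) (f : R -> R) (x : R) : Prop :=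
  if n is m.+1 then
    (\forall z \near x, nderivable m f z) /\ derivable (derive1n m f) x 1
  else True.

(* Euler's Gamma function, for [0 < z]. *)
Definition Gamma {R : realType} (z : R) : R :=
  \int[@lebesgue_measure R]_(t in `]0, +oo[) (t `^ (z - 1) * expR (- t)).

(* For [0 < q], the positive integer [n] such that [n - 1 < q <= n]. *)
Definition rl_order {R : realType} (q : R) : nat := `|Num.ceil q|%N.

Definition rl_integrand {R : realType} (q a : R) (g : R -> R) (x u : R) : R :=
  g u / (x - u) `^ (q - (rl_order q)%:R + 1).

Definition rl_integral {R : realType} (q a : R) (g : R -> R) (x : R) : R :=
  \int[@lebesgue_measure R]_(u in `]a, x[) rl_integrand q a g x u.

(* Riemann-Liouville derivative of order [q > 0] with lower limit [a]. *)
Definition rl_derive {R : realType} (q a : R) (g : R -> R) (x : R) : R :=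
  let n := rl_order q in
  if q == n%:R then derive1n n g x
  else (Gamma (n%:R - q))^-1 * derive1n n (rl_integral q a g) x.

(* The Riemann-Liouville derivative exists at [x]; for [q] not an integer, the
   integral has to make sense at all points near [x]. *)
Definition rl_derivable {R : realType} (q a : R) (g : R -> R) (x : R) : Prop :=
  let n := rl_order q in
  if q == n%:R then nderivable n g x
  else (\forall z \near x, (@lebesgue_measure R).-integrable `]a, z[
                             (EFin \o rl_integrand q a g z)) /\
       nderivable n (rl_integral q a g) x.

Section LocalFractional.
Context {R : realType}.
Variables (f : R -> R) (y q : R) (N : nat).

(* [f] is a function on [0, 1]. *)
Definition taylor_poly (x : R) : R :=
  \sum_(n < N.+1)
    nderive_within `[0, 1] n f y / Gamma (n%:R + 1) * (x - y) ^+ n.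

(* [F(y, t; q, N)] for [t > 0]. *)
Definition lf_pos (t : R) : R :=
  rl_derive q y (fun x => f x - taylor_poly x) (y + t).

Definition lf_pos_exists (t : R) : Prop :=
  rl_derivable q y (fun x => f x - taylor_poly x) (y + t).

Definition local_fderive : R := lim (lf_pos t @[t --> 0^'+]).

Definition local_fderivable : Prop :=
  (\forall t \near 0^'+, lf_pos_exists t) /\ cvg (lf_pos t @[t --> 0^'+]).

(* [F(y, t; q, N)], extended to [t = 0]. *)
Definition lf (t : R) : R := if t == 0 then local_fderive else lf_pos t.

Definition remainder_integrand (x t : R) : R := derive1 lf t * (x - y - t) `^ q.

Definition lf_remainder (x : R) : R :=
  (Gamma (q + 1))^-1 *
  \int[@lebesgue_measure R]_(t in `]0, x - y[) remainder_integrand x t.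

(* [dF/dt] must exist at every point of the open interval: with derivatives
   only almost everywhere, a Cantor-type [F] would refute the expansion. *)
Definition lf_remainder_exists (x : R) : Prop :=
  (forall t : R, 0 < t < x - y -> lf_pos_exists t /\ derivable lf t 1) /\
  (@lebesgue_measure R).-integrable `]0, x - y[
    (EFin \o remainder_integrand x).

End LocalFractional.

(* Main.v *)
Require Import Defs.
From mathcomp Require Import measurable_realfun ring lra.

(** Put [g = f - T], with [T] the Taylor polynomial, [n = N + 1], [a = n - q]
    and move [y] to [0].  By Peano's form of Taylor's theorem [g] is
    [o(t ^ N)] at [0+], hence so is [J], the convolution of [g] with
    [t ^ (a - 1) / Gamma a] ([J = g] when [q = n]).  As [F] is the [n]-th
    derivative of [J] and has a limit at [0+], all lower derivatives of [J] tend
    to [0] at [0+], so Taylor's formula expresses [J] through [F 0] and [F'].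
    The derivative [F'] is only known to exist everywhere and to be integrable
    on compact parts of [[0, x - y)], so this rests on the Vitali-Caratheodory
    form of the fundamental theorem of calculus.  If [q < n], convolving once
    more with [t ^ (- a)] turns the formula for [J] into one for the primitive
    of [g] (Fubini and the Beta integral); it is the primitive of the right-hand
    side, and both integrands are left-continuous at [x], so they agree there. *)

Set Implicit Arguments.
Unset Strict Implicit.
Unset Printing Implicit Defensive.

Local Open Scope classical_set_scope.
Local Open Scope ring_scope.
Local Notation mu := lebesgue_measure.

(** Near [x - y] the function [F'] is controlled only through the weight [(x - y - t) ^ q]. Hence
    each formula is first proved for [c < x - y], where this weight is bounded below on []0, c[],
    and the end point is reached by dominated convergence, with the weighted [F'] as majorant. For
    [q < n] the function [f] enters only through integrals, which ignore single values. Equality of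
    primitives thus decides nothing at a given point, and the left-continuity of [f] at [x] is what
    ties [f x] to them. The Gamma factors all come from [B(a, b) = Gamma a * Gamma b / Gamma (a +
    b)], which also drives the semigroup law of fractional integrals. Gamma and Beta are treated as
    extended reals until finiteness is known, so that this identity needs only Tonelli's theorem. *)

Lemma integrable_eq (R : realType) (D : set R) (f g : R -> R) : measurable D ->
  (forall x, D x -> f x = g x) ->
  mu.-integrable D (EFin \o f) -> mu.-integrable D (EFin \o g).
Proof.
move=> mD fg; apply: eq_integrable => //.
by move=> x; rewrite inE => Dx; rewrite /= fg.
Qed.

Lemma integrableD_EFin (R : realType) (D : set R) (f g : R -> R) : measurable D ->
  mu.-integrable D (EFin \o f) -> mu.-integrable D (EFin \o g) ->
  mu.-integrable D (EFin \o (fun x => f x + g x)).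
Proof.
move=> mD intf intg; have := integrableD _ intf intg => /(_ mD).
by apply: eq_integrable => // x _; rewrite /= EFinD.
Qed.

Lemma integrableZ_EFin (R : realType) (D : set R) (k : R) (f : R -> R) : measurable D ->
  mu.-integrable D (EFin \o f) ->
  mu.-integrable D (EFin \o (fun x => k * f x)).
Proof.
move=> mD intf; have := integrableZl _ k intf => /(_ mD).
by apply: eq_integrable => // x _; rewrite /= EFinM.
Qed.

Lemma integrable_le_EFin (R : realType) (D : set R) (f g : R -> R) : measurable D ->
  measurable_fun D f -> (forall x, D x -> `|f x| <= g x) ->
  mu.-integrable D (EFin \o g) -> mu.-integrable D (EFin \o f).
Proof.
move=> mD mf fg; apply: le_integrable => //; first exact/measurable_EFinP.
by move=> x Dx; rewrite /= lee_fin (le_trans (fg _ Dx))// ler_norm.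
Qed.

Lemma measurable_integrable (R : realType) (D : set R) (f : R -> R) :
  mu.-integrable D (EFin \o f) -> measurable_fun D f.
Proof. by move=> /measurable_int/measurable_EFinP. Qed.

Lemma integrable_cst_itv (R : realType) (a b : R) (k : R) :
  mu.-integrable `]a, b[ (EFin \o cst k).
Proof.
apply: measurable_bounded_integrable => //.
  by rewrite [X in (X < _)%E]lebesgue_measure_itv/=; case: ifPn => _; rewrite ?ltry// -EFinB ltry.
exact: bounded_cst.
Qed.

Lemma integrableMl_bounded (R : realType) (D : set R) (f g : R -> R) (M : R) :
  measurable D -> measurable_fun D g -> (forall x, D x -> `|g x| <= M) ->
  mu.-integrable D (EFin \o f) -> mu.-integrable D (EFin \o (fun x => f x * g x)).
Proof.
move=> mD mg gM intf.
apply: (@integrable_le_EFin _ _ _ (fun x => M * `|f x|)) => //.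
- by apply: measurable_funM => //; exact: measurable_integrable.
- by move=> x Dx; rewrite normrM mulrC ler_wpM2r// gM.
- by apply: integrableZ_EFin => //; exact: integrable_norm intf.
Qed.

Lemma cvg_Rintegral_dominated (R : realType) (D : set R) (f_ : nat -> R -> R)
    (f g : R -> R) : measurable D -> (forall n, measurable_fun D (f_ n)) ->
  measurable_fun D f -> (forall x, D x -> f_ n x @[n --> \oo] --> f x) ->
  mu.-integrable D (EFin \o g) -> (forall n x, D x -> `|f_ n x| <= g x) ->
  \int[mu]_(x in D) f_ n x @[n --> \oo] --> \int[mu]_(x in D) f x.
Proof.
move=> mD mf_ mf cvf intg fg.
have intf : mu.-integrable D (EFin \o f).
  apply: integrable_le_EFin intg => // x Dx.
  apply: (cvgr_to_le (cvg_norm (cvf x Dx))).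
  by apply: nearW => n; exact: fg.
have H := @dominated_convergence _ _ _ lebesgue_measure D mD (fun n => EFin \o f_ n) (EFin \o f) (EFin \o g).
have [||||//|_ _ Hc] := H.
- by move=> n; apply/measurable_EFinP; exact: mf_.
- exact/measurable_EFinP.
- apply: aeW => x Dx; apply: cvg_EFin; first exact: nearW.
  exact: cvf.
- exact: intg.
- by apply: aeW => x n Dx; rewrite /= lee_fin; exact: fg.
apply: fine_cvg; rewrite fineK; first exact: Hc.
exact: integrable_fin_num.
Qed.

(** * The fundamental theorem of calculus for integrable derivatives *)

(** Real induction on the set of [x] where the inequality based at [a] holds. Continuity of [F] and
    monotonicity of [G] pass the inequality to the supremum: an upward jump of [G] only helps. *)
Lemma le_increment (R : realType) (F G : R -> R) (a b : R) : a <= b ->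
  {within `[a, b], continuous F} ->
  {in `[a, b] &, {homo G : x z / x <= z}} ->
  (forall x, a <= x < b -> \forall z \near x^'+, F z - F x <= G z - G x) ->
  F b - F a <= G b - G a.
Proof.
move=> ab cF ndG incr.
pose S := [set x | a <= x <= b /\ F x - F a <= G x - G a].
have Sa : S a by split; rewrite ?lexx ?ab// !subrr.
have ubS : ubound S b by move=> x [/andP[]].
have hsS : has_sup S by split; [exists a|exists b].
have as_ : a <= sup S by apply: ub_le_sup => //; exists b.
have sb : sup S <= b by apply: ge_sup => //; exists a.
have sin : sup S \in `[a, b] by rewrite in_itv/= as_ sb.
have HsS : S (sup S).
  split; first by rewrite as_ sb.
  rewrite lerBlDr; apply/ler_addgt0Pr => e e0.
  have /subspace_continuousP/(_ _ sin)/cvgrPdist_lt/(_ _ e0) := cF.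
  rewrite near_withinE => /nbhs_ballP[d/= d0 Hd].
  have [x Sx xs] := sup_adherent d0 hsS.
  have xlt : x <= sup S by apply: ub_le_sup => //; exists b.
  case: (Sx) => xab HFx.
  have {}Hx : `|F (sup S) - F x| < e.
    apply: Hd; rewrite /ball/= ?in_itv//= ger0_norm ?subr_ge0//; lra.
  have GG : G x <= G (sup S) by apply: ndG => //; rewrite in_itv.
  move: Hx; rewrite ltr_norml => /andP[_ Hx]; lra.
have [sltb|] := ltP (sup S) b; last first.
  by move=> bs; case: HsS => _; rewrite (@le_anti _ _ (sup S) b) ?sb ?bs.
(* If [sup S < b], the local bound to the right of [sup S] puts larger points into [S]. *)
have := incr (sup S); rewrite as_ sltb => /(_ isT) near_s.
exfalso.
have [z [/= sz zb Hz]] : exists z, [/\ sup S < z, z < b & F z - F (sup S) <= G z - G (sup S)].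
  have : \forall z \near (sup S)^'+, [/\ sup S < z, z < b & F z - F (sup S) <= G z - G (sup S)].
    near=> z; split; last by near: z.
      by near: z; exact: nbhs_right_gt.
    by near: z; exact: nbhs_right_lt.
  by move=> /filter_ex.
have : S z.
  split; first by rewrite (le_trans as_ (ltW sz)) ltW.
  case: HsS => _ ?; lra.
by move=> /(sup_upper_bound hsS); rewrite leNgt sz.
Unshelve. all: by end_near. Qed.

(* Vitali-Caratheodory: [G] is the integral of a lower semicontinuous
   majorant of [h], taken constant [(k + 2) e] on an open neighbourhood of each
   level set [k e <= h < (k + 1) e]. *)
Lemma lsc_majorant_primitive (R : realType) (h : R -> R) (a b e : R) :
  a < b -> 0 < e -> (forall x, 0 <= h x) ->
  (@lebesgue_measure R).-integrable `]a, b[ (EFin \o h) ->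
  exists G : R -> R, [/\ {in `[a, b] &, {homo G : x z / x <= z}},
    (forall x, x \in `]a, b[ ->
       \forall z \near x^'+, (h x + e) * (z - x) <= G z - G x) &
    G b - G a <= \int[@lebesgue_measure R]_(x in `]a, b[) h x
      + 2 * e * (b - a) + e * e].
Proof.
move=> ab e0 h0 ih.
pose I := `]a, b[%classic : set R.
have mI : measurable I by exact: measurable_itv.
have mh : measurable_fun I h by apply/measurable_EFinP; exact: measurable_int ih.
pose E k := I `&` h @^-1` `[k%:R * e, k.+1%:R * e[.
have mE k : measurable (E k) by apply: mh => //; exact: measurable_itv.
have muS (X Y : set R) : measurable X -> measurable Y -> X `<=` Y -> (mu X <= mu Y)%E.
  by move=> mX mY XY; apply: le_measure; rewrite ?inE.
have muI : (mu I = (b - a)%:E)%E by rewrite /I lebesgue_measure_itv/= lte_fin ab.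
have muE k : (mu (E k) < +oo)%E.
  apply: (@le_lt_trans _ _ (mu I)); last by rewrite muI ltry.
  by apply: le_measure; rewrite ?inE//; [exact: mE|exact: subIsetl].
(* With the weight [c k = (k + 2) e] below, the excess of [U k] over [E k] costs at most
   [c k * d k = e * e / 2 ^ (k + 1)]; these sum to [e * e]. *)
pose d k := e / (k.+2%:R) / (2 ^ k.+1)%:R.
have d0 k : 0 < d k by rewrite /d !divr_gt0// ltr0n expn_gt0.
have /choice[U HU] k : exists V : set R, [/\ open V, E k `<=` V & (mu (V `\` E k) < (d k)%:E)%E].
  apply: lebesgue_regularity_outer; [exact: mE|exact: muE|exact: d0].
have mU k : measurable (U k) by apply: open_measurable; case: (HU k).
pose c k : R := k.+2%:R * e.
have c0 k : 0 <= c k by rewrite /c mulr_ge0 // ltW.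
pose A x k := U k `&` `]a, x]%classic.
have mA x k : measurable (A x k) by apply: measurableI => //; exact: measurable_itv.
(* This is the integral over []a, x]] of the sum of the [c k] times the indicators of the [U k]; as
   a series of measures it can be handled without forming that function. *)
pose g x := (\sum_(k <oo) ((c k)%:E * mu (A x k)))%E.
have term0 k (B : set R) : (0 <= (c k)%:E * mu B)%E by rewrite mule_ge0 ?lee_fin.
have g0 x : (0 <= g x)%E by apply: nneseries_ge0 => k _ _.
have UE : I = \bigcup_k E k.
  apply/seteqP; split => [x Ix|x [k _ []]//].
  exists (Num.truncn (h x / e)) => //; split => //=.
  rewrite in_itv/=.
  have /truncn_itv/andP[h1 h2] : 0 <= h x / e by rewrite divr_ge0 // ltW.
  by rewrite -ler_pdivlMr// h1/= -ltr_pdivrMr.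
have tE : trivIset setT E.
  apply/trivIsetP => i j _ _ ij; rewrite -subset0 => x [[_ /=]].
  rewrite in_itv/= => /andP[i1 i2] [_ /=]; rewrite in_itv/= => /andP[j1 j2].
  have := le_lt_trans i1 j2; have := le_lt_trans j1 i2.
  rewrite !ltr_pM2r // !ltr_nat !ltnS => ji ij'.
  by move: ij; rewrite eqn_leq ij' ji.
(* On [E k] one has [c k <= h + 2 * e]. The [E k] partition the interval, so they contribute at most
   the integral of [h + 2 * e]; the excesses account for [e * e]. *)
have gb x : x <= b -> (g x <= (\int[mu]_(x in I) h x
      + 2 * e * (b - a) + e * e)%:E)%E.
  move=> xb.
  have Bd k : ((c k)%:E * mu (A x k) <= (c k)%:E * mu (E k) + (e * e / (2 ^ k.+1)%:R)%:E)%E.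
    have [oU sEU ltU] := HU k.
    apply: (@le_trans _ _ ((c k)%:E * mu (U k))%E).
      by rewrite lee_wpmul2l ?lee_fin// muS//; exact: subIsetl.
    have -> : (mu (U k) = mu (E k) + mu (U k `\` E k))%E.
      rewrite -measureU//; last 3 first.
        exact: mE.
        by apply: measurableD; [exact: mU|exact: mE].
        by rewrite setIDA setIC -setIDA setDv setI0.
      by rewrite setDUK.
    rewrite ge0_muleDr// leeD2l//.
    apply: (@le_trans _ _ ((c k)%:E * (d k)%:E)%E).
      by rewrite lee_wpmul2l ?lee_fin// ltW.
    have k2 : k.+2%:R != 0 :> R by rewrite pnatr_eq0.
    have p0 : (2 ^ k.+1)%:R != 0 :> R by rewrite pnatr_eq0 expn_eq0.
    rewrite -EFinM lee_fin /c /d; move: p0 k2; set p := (2 ^ _)%:R; set m := k.+2%:R => p0 m0. clearbody p m.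
    by rewrite (_ : m * e * _ = e * e / p)//; field; rewrite p0 m0.
  apply: (@le_trans _ _ (\sum_(k <oo) ((c k)%:E * mu (E k) + (e * e / (2 ^ k.+1)%:R)%:E))%E).
    by apply: lee_nneseries.
  apply: le_trans; first by apply: epsilon_trick => //; rewrite mulr_ge0 ?ltW.
  rewrite !EFinD leeD2r//.
  have mh2 : measurable_fun I (fun x : R => (h x + 2 * e)%:E).
    by apply/measurable_EFinP; apply: measurable_funD.
  apply: (@le_trans _ _ (\sum_(k <oo) \int[mu]_(x in E k) (h x + 2 * e)%:E)%E).
    apply: lee_nneseries => // k _.
    rewrite -integral_cst; last exact: mE.
    apply: ge0_le_integral; first exact: mE.
    - by move=> z _; rewrite lee_fin.
    - exact: measurable_cst.
    - apply: (measurable_funS mI _ mh2); exact: subIsetl.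
    - move=> z [Iz /=]; rewrite in_itv/= => /andP[h1 h2]; rewrite lee_fin /c.
      by apply: le_trans (lerD h1 (lexx _)); rewrite -mulrDl -natrD addn2.
  rewrite -ge0_integral_bigcup//; last 2 first.
    by rewrite -UE.
    by move=> z _; rewrite lee_fin addr_ge0 ?h0// mulr_ge0// ltW.
  rewrite -UE.
  under eq_integral do rewrite EFinD.
  rewrite ge0_integralD//; last 3 first.
  - by move=> z _; rewrite lee_fin.
  - exact/measurable_EFinP.
  - by move=> z _; rewrite lee_fin mulr_ge0// ltW.
  rewrite integral_cst// [X in (_ + _ * X)%E]muI -EFinM /Rintegral fineK//.
  exact: integrable_fin_num.
have gfin x : x <= b -> g x \is a fin_num.
  by move=> xb; rewrite ge0_fin_numE// (le_lt_trans (gb _ xb)) ?ltry.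
exists (fine \o g); split.
- move=> x z; rewrite !in_itv/= => /andP[_ xb] /andP[_ zb] xz.
  rewrite fine_le ?gfin// /g; apply: lee_nneseries => // k _.
  rewrite lee_wpmul2l ?lee_fin// muS//.
  apply: setIS => t /=; rewrite !in_itv/= => /andP[-> tx]/=; exact: le_trans xz.
- move=> x xab; have ax : a < x by move: xab; rewrite in_itv => /andP[].
  have : I x by [].
  rewrite UE => -[j _ Ejx].
  (* As [U j] is open around [x], it contains []x, z]] for [z] close to [x], so that [g] grows there
     at least at the rate [c j > h x + e]. *)
  have [oU sEU _] := HU j.
  have Ux := sEU _ Ejx.
  have [r /= r0 Br] : exists2 r : R, 0 < r & ball x r `<=` U j by apply/nbhs_ballP; exact: open_nbhs_nbhs.
  near=> z.
  have xz : x < z by near: z; exact: nbhs_right_gt.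
  have zb : z < b by near: z; apply: nbhs_right_lt; have := xab; rewrite in_itv => /andP[].
  have zr : z < x + r by near: z; apply: nbhs_right_lt; rewrite ltrDl.
  have gz : (g z = g x + \sum_(k <oo) ((c k)%:E * mu (U k `&` `]x, z])))%E.
    rewrite /g -nneseriesD//; apply: eq_eseriesr => k _.
    rewrite -ge0_muleDr//; congr (_ * _)%E.
    have -> : A z k = A x k `|` (U k `&` `]x, z]).
      rewrite /A -setIUr; congr (_ `&` _).
      rewrite -itv_bndbnd_setU //.
        by rewrite bnd_simp ltW.
      by rewrite bnd_simp ltW.
    rewrite measureU//; [exact: mA|by apply: measurableI; [exact: mU|exact: measurable_itv]|].
    rewrite -subset0 => t [[_ /=]]; rewrite in_itv/= => /andP[_ tx] [_ /=].
    by rewrite in_itv/= ltNge tx.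
  have Hj : ((c j * (z - x))%:E <= \sum_(k <oo) ((c k)%:E * mu (U k `&` `]x, z])))%E.
    have -> : ((c j * (z - x))%:E = (c j)%:E * mu (U j `&` `]x, z]))%E.
      rewrite setIidr; first by rewrite lebesgue_measure_itv/= lte_fin xz EFinM.
      move=> t /=; rewrite in_itv/= => /andP[xt tz]; apply: Br.
      by rewrite /ball/= ltr_norml; lra.
    apply: le_trans (nneseries_lim_ge j.+1 _) => //.
    by rewrite big_nat_recr//= leeDr// sume_ge0.
  have : g z \is a fin_num by apply: gfin; exact: ltW.
  have : g x \is a fin_num by apply: gfin; exact: ltW (lt_trans xz zb).
  move=> gx_fin gz_fin.
  have : ((c j * (z - x))%:E <= (fine (g z) - fine (g x))%:E)%E.
    by rewrite EFinB !fineK// gz addrAC subee// add0e.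
  rewrite lee_fin; apply: le_trans; rewrite ler_pM2r ?subr_gt0//.
  case: Ejx => _ /=; rewrite in_itv/= => /andP[_ hx].
  by rewrite /c -[j.+2]addn1 natrD mulrDl mul1r lerD2r ltW.
- have ga : g a = 0%E.
    rewrite /g eseries0// => k _ _.
    by rewrite /A set_itvoc0 setI0 measure0 mule0.
  by rewrite /= ga subr0 -lee_fin fineK ?gfin// gb.
Unshelve. all: by end_near. Qed.

Lemma is_derive_le_right (R : realType) (F : R -> R) (x l m : R) :
  is_derive x 1 F l -> l < m -> \forall z \near x^'+, F z - F x <= m * (z - x).
Proof.
move=> [dF Fl] lm.
have : (h^-1 *: (F (h *: 1 + x) - F x)) @[h --> 0^'] --> l.
  by rewrite -Fl; exact: dF.
move=> /cvgrPdist_lt/(_ (m - l)); rewrite subr_gt0 => /(_ lm).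
move=> /nbhs_ballP[r/= r0 Hr].
near=> z.
have xz : x < z by near: z; exact: nbhs_right_gt.
have zr : z < x + r by near: z; apply: nbhs_right_lt; rewrite ltrDl.
have zx : z - x != 0 by rewrite subr_eq0 gt_eqF.
have := Hr (z - x) _ zx; rewrite /ball/= sub0r normrN => /(_ _)H.
have {}H : `|l - (z - x)^-1 *: (F ((z - x) *: 1 + x) - F x)| < m - l.
  by apply: H; rewrite ger0_norm ?subr_ge0; lra.
move: H; rewrite /GRing.scale/= mulr1 subrK ltr_norml => /andP[H _].
rewrite -ler_pdivrMr ?subr_gt0// mulrC; lra.
Unshelve. all: by end_near. Qed.

(** The derivative of [F] stays strictly below [h x + e], a lower bound for the right growth rate of
    the majorant primitive, so [le_increment] compares the two; then [e] tends to 0. Nonnegativity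
    of [h] lets its level sets be indexed by [nat]. *)
Lemma increment_le_Rintegral (R : realType) (F f h : R -> R) (a b : R) :
  a < b -> {within `[a, b], continuous F} ->
  (forall x, x \in `]a, b[ -> is_derive x 1 F (f x)) ->
  (forall x, x \in `]a, b[ -> f x <= h x) ->
  (forall x, 0 <= h x) ->
  mu.-integrable `]a, b[ (EFin \o h) ->
  F b - F a <= \int[mu]_(x in `]a, b[) h x.
Proof.
move=> ab cF dF fh h0 ih; set J := Rintegral _ _ _.
suff bnd e : 0 < e -> e < 1 -> F b - F a <= J + e * (2 * (b - a) + 1).
  apply/ler_addgt0Pr => e e0.
  set k := 2 * (b - a) + 1.
  have k0 : 0 < k by rewrite /k; lra.
  (* The cap [1 / 2] keeps the parameter below 1, where its square is at most itself; both error
     terms then merge into a multiple of [k]. *)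
  have m0 : 0 < Order.min (e / k) (1 / 2) by rewrite lt_min !divr_gt0.
  apply: le_trans (bnd _ m0 _) _; first by rewrite gt_min; apply/orP; right; lra.
  by rewrite lerD2l -/k -ler_pdivlMr// ge_min lexx.
move=> e0 e1.
have [G [ndG incG Gab]] := lsc_majorant_primitive ab e0 h0 ih.
(* Nothing is known about the derivative at [a], so the comparison starts at [a' > a]; continuity of
   [F] then moves [a'] to [a]. *)
have key a' : a < a' < b -> F b - (G b - G a) <= F a'.
  move=> /andP[aa' a'b].
  have : F b - F a' <= G b - G a'.
    apply: le_increment; first exact: ltW.
    - apply: continuous_subspaceW cF; apply: subset_itv; rewrite bnd_simp//; exact: ltW.
    - move=> x z; rewrite !in_itv/= => /andP[? ?] /andP[? ?]; apply: ndG; rewrite in_itv/=; lra.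
    - move=> x /andP[a'x xb].
      have xI : x \in `]a, b[ by rewrite in_itv/=; lra.
      have fhe : f x < h x + e by have := fh _ xI; lra.
      have := is_derive_le_right (dF _ xI) fhe; have := incG _ xI.
      by apply: filterS2 => z h1 h2; exact: le_trans h2 h1.
  have : G a <= G a' by apply: ndG; rewrite ?in_itv/=; lra.
  lra.
have Fa : F z @[z --> a^'+] --> F a.
  by have /(continuous_within_itvP _ ab)[] := cF.
have Fab : F b - (G b - G a) <= F a.
  apply: cvgr_to_ge Fa _.
  near=> z; apply: key; apply/andP; split; near: z.
    exact: nbhs_right_gt.
  exact: nbhs_right_lt.
have : e * e <= e by rewrite ler_piMl// ltW.
rewrite /J; lra.
Unshelve. all: by end_near. Qed.

(** Cutting [f] off below at [- n] and adding [n * x] to [F] produces a nonnegative majorant. The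
    added terms cancel, and dominated convergence under [|f|] removes the cut-off. *)
Lemma increment_le_Rintegral_derive (R : realType) (F f : R -> R) (a b : R) :
  a < b -> {within `[a, b], continuous F} ->
  (forall x, x \in `]a, b[ -> is_derive x 1 F (f x)) ->
  mu.-integrable `]a, b[ (EFin \o f) ->
  F b - F a <= \int[mu]_(x in `]a, b[) f x.
Proof.
move=> ab cF dF intf.
have mI : measurable (`]a, b[ : set R) by exact: measurable_itv.
have mf : measurable_fun `]a, b[ f by apply/measurable_EFinP; exact: measurable_int intf.
pose fn (n : nat) x := Order.max (f x) (- n%:R).
have mfn n : measurable_fun `]a, b[ (fn n) by exact: measurable_maxr.
have fnf n x : `|fn n x| <= `|f x|.
  rewrite /fn; have n0 : 0 <= n%:R :> R by [].
  have := ler_norm (f x); have := ler_norm (- f x); rewrite normrN => h1 h2.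
  by have [h|h] := leP (f x) (- n%:R); rewrite ?lexx// ler_norml; apply/andP; split; lra.
have ifn n : mu.-integrable `]a, b[ (EFin \o fn n).
  apply: (le_integrable _ _ _ intf) => //; first by apply/measurable_EFinP; exact: mfn.
  by move=> x _; rewrite /= lee_fin fnf.
have bnd n : F b - F a <= \int[mu]_(x in `]a, b[) fn n x.
  have := @increment_le_Rintegral R (fun x => F x + n%:R * x) (fun x => f x + n%:R) (fun x => fn n x + n%:R) a b ab.
  have -> : \int[mu]_(x in `]a, b[) (fn n x + n%:R) = \int[mu]_(x in `]a, b[) fn n x + n%:R * (b - a).
    rewrite RintegralD//; last exact: integrable_cst_itv.
    rewrite Rintegral_cst//; congr (_ + _ * _).
    by rewrite [X in fine X]lebesgue_measure_itv/= lte_fin ab.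
  move=> H; have {}H : F b + n%:R * b - (F a + n%:R * a) <= \int[mu]_(x in `]a, b[) fn n x + n%:R * (b - a).
    apply: H.
    - move=> x; apply: continuousD; first exact: cF.
      by apply: continuous_subspaceT => z; apply: cvgMr; exact: cvg_id.
    - move=> x /dF dFx; apply: is_deriveD.
      have : is_derive x 1 (n%:R \*: (@id R)) (n%:R *: 1) by exact: is_deriveZ.
      by rewrite [_ *: _]mulr1.
    - by move=> x _; rewrite lerD2r /fn le_max lexx.
    - by move=> x; rewrite /fn -[leLHS](addNr n%:R) lerD2r le_max lexx orbT.
    - by apply: integrableD_EFin => //; exact: integrable_cst_itv.
  lra.
have : \int[mu]_(x in `]a, b[) fn n x @[n --> \oo] --> \int[mu]_(x in `]a, b[) f x.
  apply: (@cvg_Rintegral_dominated _ _ _ _ (fun x => `|f x|)) => //.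
    move=> x _; apply: cvg_near_cst; near=> n.
    apply: max_l; rewrite lerNl (le_trans (ler_norm _))// normrN.
    by near: n; exact: nbhs_infty_ger.
  exact: integrable_norm intf.
move=> /cvgr_to_ge; apply; exact: nearW.
Unshelve. all: by end_near. Qed.

(** The one-sided estimate is applied to [F] and to [- F]. *)
Lemma Rintegral_derive (R : realType) (F f : R -> R) (a b : R) :
  a < b -> {within `[a, b], continuous F} ->
  (forall x, x \in `]a, b[ -> is_derive x 1 F (f x)) ->
  mu.-integrable `]a, b[ (EFin \o f) ->
  \int[mu]_(x in `]a, b[) f x = F b - F a.
Proof.
move=> ab cF dF intf; apply/eqP; rewrite eq_le increment_le_Rintegral_derive// andbT.
have mI : measurable (`]a, b[ : set R) by exact: measurable_itv.
have : - F b - - F a <= \int[mu]_(x in `]a, b[) (-1 * f x).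
  apply: (@increment_le_Rintegral_derive R (fun x => - F x)) => //.
  - by move=> x; apply: continuousN; exact: cF.
  - by move=> x /dF dFx; rewrite mulN1r; exact: is_deriveN.
  - exact: integrableZ_EFin.
by rewrite RintegralZl//; lra.
Qed.

(** * Taylor expansions with integral remainder *)

Lemma is_derive_continuous (R : realType) (F : R -> R) (x l : R) :
  is_derive x 1 F l -> {for x, continuous F}.
Proof. by move=> dF; apply: differentiable_continuous; apply/derivable1_diffP; exact: ex_derive. Qed.

Lemma is_derive_near_eq (R : realType) (F G : R -> R) (x l : R) :
  (\forall z \near x, F z = G z) -> is_derive x 1 F l -> is_derive x 1 G l.
Proof.
move=> FG dF.
exact: near_eq_is_derive FG dF.
Qed.

(** One-sided limits replace the end values, because at [0] the functions integrated later are known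
    only from the right. *)
Lemma Rintegral_derive_cvg (R : realType) (F f : R -> R) (a b la lb : R) :
  a < b -> (forall x, x \in `]a, b[ -> is_derive x 1 F (f x)) ->
  F x @[x --> a^'+] --> la -> F x @[x --> b^'-] --> lb ->
  mu.-integrable `]a, b[ (EFin \o f) ->
  \int[mu]_(x in `]a, b[) f x = lb - la.
Proof.
move=> ab dF Fa Fb intf.
pose G x := if x <= a then la else if b <= x then lb else F x.
have Ga : G a = la by rewrite /G lexx.
have Gb : G b = lb by rewrite /G lexx leNgt ab.
have GF x : a < x < b -> G x = F x.
  by move=> /andP[ax xb]; rewrite /G !leNgt ax xb.
have dG x : x \in `]a, b[ -> is_derive x 1 G (f x).
  move=> xab; apply: (is_derive_near_eq _ (dF _ xab)).
  move: xab; rewrite in_itv/= => /andP[ax xb].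
  near=> z; rewrite GF//; apply/andP; split; near: z.
    exact: lt_nbhsr.
  exact: lt_nbhsl.
rewrite -Ga -Gb; apply: Rintegral_derive => //.
apply/continuous_within_itvP => //; split.
- by move=> x xab; apply: is_derive_continuous (dG _ xab).
- rewrite Ga; apply: cvg_trans Fa; apply: near_eq_cvg; near=> z.
  rewrite GF//; apply/andP; split; near: z.
    exact: nbhs_right_gt.
  exact: nbhs_right_lt.
- rewrite Gb; apply: cvg_trans Fb; apply: near_eq_cvg; near=> z.
  rewrite GF//; apply/andP; split; near: z.
    exact: nbhs_left_gt.
  exact: nbhs_left_lt.
Unshelve. all: by end_near. Qed.

(** * Orders of vanishing at 0+ *)

Lemma MVT_norm_le (R : realType) (v w : R -> R) (s t M : R) : s < t ->
  (forall x, s <= x <= t -> is_derive x 1 v (w x)) ->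
  (forall x, s <= x <= t -> `|w x| <= M) -> `|v t - v s| <= M * (t - s).
Proof.
move=> st dv wM.
have [||x xst] := @MVT R v w s t st.
- by move=> x xst; move: xst; rewrite in_itv/= => /andP[? ?]; apply: dv; rewrite !ltW.
- apply: derivable_within_continuous => z; rewrite in_itv/= => /dv dvz; exact: ex_derive.
- move=> ->; have ts : 0 < t - s by rewrite subr_gt0.
  rewrite normrM (gtr0_norm ts) ler_pM2r//.
  by apply: wM; move: xst; rewrite in_itv/= => /andP[? ?]; rewrite !ltW.
Qed.

(** Landau's [w t = o(t ^ m)] at [0+], written without division; [m = 0] means convergence to 0. *)
Definition little0 (R : realType) (m : nat) (w : R -> R) :=
  forall e, 0 < e -> \forall t \near (0 : R)^'+, `|w t| <= e * t ^+ m.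

Lemma little0_cvg (R : realType) (w : R -> R) (l : R) :
  w t @[t --> 0^'+] --> l <-> little0 0 (fun t => w t - l).
Proof.
split=> [/cvgrPdist_le H e e0|H].
  by have := H _ e0; apply: filterS => t; rewrite expr0 mulr1 distrC.
by apply/cvgrPdist_le => e e0; have := H _ e0; apply: filterS => t; rewrite expr0 mulr1 distrC.
Qed.

Lemma little0_le (R : realType) (m n : nat) (w : R -> R) : (m <= n)%N ->
  little0 n w -> little0 m w.
Proof.
move=> mn H e e0; near=> t.
have t0 : 0 < t by near: t; exact: nbhs_right_gt.
have t1 : t < 1 by near: t; exact: nbhs_right_lt.
have : `|w t| <= e * t ^+ n by near: t; exact: H.
by move=> /le_trans; apply; rewrite ler_pM2l// ler_wiXn2l// ltW.
Unshelve. all: by end_near. Qed.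

(** The mean value theorem on [[s, t]] gains one factor [t]; then [s] tends to [0+], because the
    value [v 0] itself is unrelated to the limit. *)
Lemma little0_primitive (R : realType) (m : nat) (v w : R -> R) :
  (\forall t \near (0 : R)^'+, is_derive (t : R) 1 v (w t)) ->
  v t @[t --> 0^'+] --> 0 -> little0 m w -> little0 m.+1 v.
Proof.
move=> dv v0 lw e e0.
have [r/= r0 Hr] : exists2 r : R, 0 < r & forall t, 0 < t < r ->
    is_derive t 1 v (w t) /\ `|w t| <= e * t ^+ m.
  have : \forall t \near (0 : R)^'+, is_derive (t : R) 1 v (w t) /\ `|w t| <= e * t ^+ m.
    by apply: filterS2 dv (lw _ e0).
  move=> /nbhs_ballP[r/= r0 H]; exists r => // t /andP[t0 tr]; apply: H => //.
  by rewrite /ball/= sub0r normrN gtr0_norm.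
near=> t.
have t0 : 0 < t by near: t; exact: nbhs_right_gt.
have tr : t < r by near: t; exact: nbhs_right_lt.
have H s : 0 < s < t -> `|v t - v s| <= e * t ^+ m * t.
  move=> /andP[s0 st]; apply: le_trans (_ : e * t ^+ m * (t - s) <= _).
    apply: (@MVT_norm_le _ v w) => // x /andP[sx xt].
      by have [] := Hr x; rewrite ?(lt_le_trans s0 sx) ?(le_lt_trans xt tr).
    have [|_ /le_trans->//] := Hr x; first by rewrite (lt_le_trans s0 sx) (le_lt_trans xt tr).
    by rewrite ler_pM2l// lerXn2r ?nnegrE//; lra.
  by rewrite ler_wpM2l ?mulr_ge0 ?exprn_ge0 ?ltW//; lra.
rewrite exprSr mulrA -[v t]subr0.
have Hc : `|v t - v s| @[s --> 0^'+] --> `|v t - 0|.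
  by apply: cvg_norm; apply: cvgB => //; exact: cvg_cst.
apply: cvgr_to_le Hc _; near=> s; apply: H; apply/andP; split; near: s.
  exact: nbhs_right_gt.
exact: nbhs_right_lt.
Unshelve. all: by end_near. Qed.

(** [u t + M * t] is nondecreasing and bounded below on a right neighbourhood of 0, hence has a
    limit there. *)
Lemma cvg_at_right_lipschitz (R : realType) (u w : R -> R) (M : R) :
  (\forall t \near (0 : R)^'+, is_derive (t : R) 1 u (w t)) ->
  (\forall t \near (0 : R)^'+, `|w t| <= M) -> cvg (u t @[t --> 0^'+]).
Proof.
move=> du wM.
have [r/= r0 Hr] : exists2 r : R, 0 < r & forall t, 0 < t < r ->
    is_derive t 1 u (w t) /\ `|w t| <= M.
  have : \forall t \near (0 : R)^'+, is_derive (t : R) 1 u (w t) /\ `|w t| <= M.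
    by apply: filterS2 du wM.
  move=> /nbhs_ballP[r/= r0 H]; exists r => // t /andP[t0 tr]; apply: H => //.
  by rewrite /ball/= sub0r normrN gtr0_norm.
have M0 : 0 <= M.
  have [|_] := Hr (r / 2); first by apply/andP; split; lra.
  exact: le_trans.
have lip s t : 0 < s -> s <= t -> t < r -> `|u t - u s| <= M * (t - s).
  move=> s0; rewrite le_eqVlt => /predU1P[->|st] tr; first by rewrite !subrr normr0 mulr0.
  by apply: (@MVT_norm_le _ u w) => // x /andP[sx xt]; have [|] := Hr x => //;
    rewrite (lt_le_trans s0 sx) (le_lt_trans xt tr).
pose v t := u t + M * t.
have cv : cvg (v t @[t --> 0^'+]).
  apply/cvg_ex; eexists; apply: (@nondecreasing_at_right_cvgr _ _ _ (BLeft r)).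
  - by rewrite bnd_simp.
  - move=> s t; rewrite !in_itv/= => /andP[s0 sr] /andP[t0 tr] st.
    by have := lip _ _ s0 st tr; rewrite ler_norml /v => /andP[]; lra.
  - exists (u (r / 2) - M * r) => z [t] /=; rewrite in_itv/= => /andP[t0 tr] <- {z}.
    have Mt : 0 <= M * t by rewrite mulr_ge0// ltW.
    have Mrt : 0 <= M * (r - t) by rewrite mulr_ge0// subr_ge0 ltW.
    have Mr : 0 <= M * r by rewrite mulr_ge0// ltW.
    have [tr2|tr2] := leP t (r / 2).
      by have := lip _ _ t0 tr2 ltac:(lra); rewrite ler_norml /v => /andP[]; lra.
    by have := lip (r / 2) t ltac:(lra) (ltW tr2) tr; rewrite ler_norml /v => /andP[]; lra.
have -> : u = (fun t => v t - M * t) by apply/funext => t; rewrite /v addrK.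
apply: is_cvgB => //; apply: is_cvgMr; apply: cvgP; apply: cvg_at_right_filter; exact: cvg_id.
Qed.

(* If the top derivative is bounded near 0+, all lower ones have limits there;
   a nonzero limit of [u k] would force [u 0] to be of exact order [t ^ k]. *)
Lemma little0_cvg_derivatives (R : realType) (n : nat) (u : nat -> R -> R) (M : R) :
  (forall k, (k <= n)%N -> \forall t \near (0 : R)^'+, is_derive (t : R) 1 (u k) (u k.+1 t)) ->
  (\forall t \near (0 : R)^'+, `|u n.+1 t| <= M) ->
  little0 n (u 0%N) ->
  forall k, (k <= n)%N -> u k t @[t --> 0^'+] --> 0.
Proof.
move=> du bu u0.
(* Descent from the top: a bound on one derivative gives the next lower one a limit, hence a
   bound. *)
have bd j : (j <= n)%N -> exists M : R, \forall t \near (0 : R)^'+, `|u (n.+1 - j)%N t| <= M.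
  elim: j => [|j IH] jn; first by exists M; rewrite subn0.
  have [M' HM'] := IH (ltnW jn).
  rewrite subSn 1?ltnW// in HM'; rewrite subSS.
  have /cvg_ex[l Hl] := cvg_at_right_lipschitz (du _ (leq_subr j n)) HM'.
  exists (`|l| + 1).
  have /cvgr_le : `|u (n - j)%N t| @[t --> 0^'+] --> `|l| by exact: cvg_norm.
  by apply; rewrite ltrDl.
have cu k : (k <= n)%N -> exists l : R, u k t @[t --> 0^'+] --> l.
  move=> kn; have [|M' HM'] := bd (n - k)%N; first exact: leq_subr.
  move: HM'; rewrite subSn ?leq_subr// subKn// => HM'.
  by have /cvg_ex := cvg_at_right_lipschitz (du _ kn) HM'.
elim/ltn_ind => k IH kn.
have [l Hl] := cu _ kn; have [l0|l0] := eqVneq l 0; first by rewrite l0 in Hl.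
have {}Hl : little0 0 (fun t => u k t - l) by apply/little0_cvg.
(* [u k = l + o(1)] is integrated down [j] levels. The integration constants vanish because [u i]
   tends to 0 for [i < k]; the constant [c] obtained is [l / j!]. *)
have key j : (j <= k)%N -> exists2 c : R, c != 0 & little0 j (fun t => u (k - j)%N t - c * t ^+ j).
  elim: j => [|j IHj] jk.
    exists l => // e e0; rewrite subn0; have := Hl e e0.
    by apply: filterS => t; rewrite expr0 !mulr1.
  have [c c0 Hc] := IHj (ltnW jk).
  exists (c / j.+1%:R); first by rewrite mulf_neq0// invr_neq0// pnatr_eq0.
  have e : (k - j = (k - j.+1).+1)%N by rewrite -subSn.
  apply: little0_primitive Hc; last first.
    rewrite -[X in _ --> X]subr0; apply: cvgB.
      by apply: IH; rewrite ?(leq_trans (leq_subr _ _)) ?ltn_subrL ?(leq_ltn_trans _ jk).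
    rewrite -[X in _ --> X](mulr0 (c / j.+1%:R)); apply: cvgMr.
    rewrite -[X in _ --> X](expr0n R j.+1)/=.
    by apply: cvg_at_right_filter; exact: exprn_continuous.
  have := du (k - j.+1)%N; rewrite (leq_trans (leq_subr _ _))// => /(_ isT).
  apply: filterS => t dt; rewrite e.
  apply: is_deriveB.
  have : is_derive t 1 ((c / j.+1%:R) \*: (@id R ^+ j.+1)) ((c / j.+1%:R) *: ((j.+1%:R * t ^+ j) *: 1)).
    apply: is_deriveZ; exact: is_deriveX.
  have -> : (c / j.+1%:R) *: ((j.+1%:R * t ^+ j) *: 1) = c * t ^+ j.
    rewrite /GRing.scale/= mulr1 mulrA divfK// pnatr_eq0//.
  rewrite (_ : _ \*: _ = fun x : R => c / j.+1%:R * x ^+ j.+1)//.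
  apply/funext => x /=; rewrite exprfctE//.
have [c c0 Hc] := key k (leqnn k); rewrite subnn in Hc.
have u0k := little0_le kn u0.
(* Two errors of one third each would give [|c| * t ^ k <= 2 / 3 * |c| * t ^ k]. *)
have c2 : 0 < `|c| / 3 by rewrite divr_gt0// normr_gt0.
exfalso.
have [t [t0 h1 h2]] : exists t : R, [/\ 0 < t, `|u 0%N t| <= `|c| / 3 * t ^+ k &
    `|u 0%N t - c * t ^+ k| <= `|c| / 3 * t ^+ k].
  suff : \forall t \near (0 : R)^'+, [/\ 0 < t, `|u 0%N t| <= `|c| / 3 * t ^+ k &
    `|u 0%N t - c * t ^+ k| <= `|c| / 3 * t ^+ k] by move=> /filter_ex.
  near=> t; split; near: t; [exact: nbhs_right_gt|exact: u0k|exact: Hc].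
have tk : 0 < t ^+ k by rewrite exprn_gt0.
have : `|c * t ^+ k| <= `|u 0%N t| + `|u 0%N t - c * t ^+ k|.
  by rewrite -{1}[c * _](subKr (u 0%N t)); exact: ler_normB.
rewrite normrM (gtr0_norm tk) => h3.
have : 0 < `|c| * t ^+ k by rewrite mulr_gt0// normr_gt0.
by move: h1 h2 h3; rewrite mulrAC; lra.
Unshelve. all: by end_near. Qed.

(** The sum of derivatives telescopes: differentiating the power in one term cancels what
    differentiating [u] left in the term before. *)
Lemma is_derive_taylor_tail (R : realType) (u : nat -> R -> R) (n : nat) (c t : R) :
  (forall k, (k <= n)%N -> is_derive t 1 (u k) (u k.+1 t)) ->
  is_derive t 1 (fun s => \sum_(k < n.+1) u k s * ((c - s) ^+ k / k`!%:R))
    (u n.+1 t * ((c - t) ^+ n / n`!%:R)).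
Proof.
elim: n => [|n IH] du.
  rewrite (_ : (fun s => _) = u 0%N); last first.
    by apply/funext => s; rewrite big_ord1 expr0 fact0 divr1 mulr1.
  by rewrite expr0 fact0 divr1 mulr1; exact: du.
rewrite (_ : (fun s => _) = (fun s => \sum_(k < n.+1) u k s * ((c - s) ^+ k / k`!%:R))
    + (u n.+1 * (fun s => (c - s) ^+ n.+1 / n.+1`!%:R))); last first.
  by apply/funext => s; rewrite big_ord_recr.
have dp : is_derive t 1 (fun s : R => (c - s) ^+ n.+1 / n.+1`!%:R) (- ((c - t) ^+ n / n`!%:R)).
  have d1 : is_derive t 1 (fun s : R => c - s) (-1).
    by rewrite -[-1]add0r; apply: is_deriveB.
  have := is_deriveX n.+1 d1 => d2.
  have := is_deriveZ (n.+1`!%:R^-1) d2.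
  rewrite (_ : _ \*: _ = fun s : R => (c - s) ^+ n.+1 / n.+1`!%:R); last first.
    by apply/funext => s; rewrite /= exprfctE /GRing.scale/= mulrC.
  rewrite (_ : _ *: _ = - ((c - t) ^+ n / n`!%:R))// /GRing.scale/= factS natrM.
  have n1 : n.+1%:R != 0 :> R by rewrite pnatr_eq0.
  have nf : n`!%:R != 0 :> R by rewrite pnatr_eq0 -lt0n fact_gt0.
  by field; rewrite nf addrC natr1 n1.
have := is_deriveD (IH (fun k kn => du k (leqW kn))) (is_deriveM (du n.+1 (leqnn _)) dp).
rewrite (_ : _ + (_ + _) = u n.+2 t * ((c - t) ^+ n.+1 / n.+1`!%:R))//.
by rewrite /GRing.scale/= mulrN addrA subrr add0r mulrC.
Qed.

(** The fundamental theorem is applied to the sum [P] of the preceding lemma. At [0+] only its last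
    term survives, with limit [F0 * c ^ n / n!]; at [c] only its first, since the powers of [c - s]
    vanish. That [c < h] makes [P] continuous at [c]. *)
Lemma taylor_integral_remainder (R : realType) (n : nat) (u : nat -> R -> R) (F0 c h : R) :
  0 < c < h ->
  (forall k t, (k <= n)%N -> 0 < t < h -> is_derive t 1 (u k) (u k.+1 t)) ->
  (forall k, (k < n)%N -> u k t @[t --> 0^'+] --> 0) ->
  u n t @[t --> 0^'+] --> F0 ->
  mu.-integrable `]0, c[ (EFin \o u n.+1) ->
  u 0%N c = F0 * (c ^+ n / n`!%:R) +
    \int[mu]_(t in `]0, c[) (u n.+1 t * ((c - t) ^+ n / n`!%:R)).
Proof.
move=> /andP[c0 ch] du uk un intu.
pose P s := \sum_(k < n.+1) u k s * ((c - s) ^+ k / k`!%:R).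
have dP t : 0 < t < h -> is_derive t 1 P (u n.+1 t * ((c - t) ^+ n / n`!%:R)).
  by move=> th; apply: is_derive_taylor_tail => k kn; exact: du.
have cpow k : (c - s) ^+ k / k`!%:R @[s --> 0^'+] --> c ^+ k / k`!%:R.
  have : {for 0, continuous (fun s : R => (c - s) ^+ k / k`!%:R)}.
    apply: cvgMl; apply: (@continuous_comp _ _ _ (fun s => c - s) (fun s => s ^+ k)).
      by apply: continuousB => //; exact: cst_continuous.
    exact: exprn_continuous.
  by move=> /cvg_at_right_filter; rewrite subr0.
have P0 : P s @[s --> 0^'+] --> F0 * (c ^+ n / n`!%:R).
  rewrite (_ : P = fun s => \sum_(k < n) u k s * ((c - s) ^+ k / k`!%:R) + u n s * ((c - s) ^+ n / n`!%:R)); last first.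
    by apply/funext => s; rewrite /P big_ord_recr.
  rewrite -[X in _ --> X]add0r; apply: cvgD; last exact: cvgM.
  have : \sum_(k < n) u k s * ((c - s) ^+ k / k`!%:R) @[s --> 0^'+] -->
      \sum_(k < n) 0 * (c ^+ k / k`!%:R).
    apply: cvg_big => [|k _]; first exact: add_continuous.
    by apply: cvgM => //; exact: uk.
  by rewrite big1// => k _; rewrite mul0r.
have Pc : P s @[s --> c^'-] --> u 0%N c.
  have -> : u 0%N c = P c.
    rewrite /P big_ord_recl/= subrr expr0 fact0 divr1 mulr1 big1 ?addr0// => i _.
    by rewrite exprS !mul0r mulr0.
  apply: cvg_at_left_filter; apply: is_derive_continuous; apply: dP; exact/andP.
rewrite (@Rintegral_derive_cvg _ P _ 0 c _ _ c0 _ P0 Pc); first by rewrite addrC subrK.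
  by move=> t; rewrite in_itv/= => /andP[t0 tc]; apply: dP; rewrite t0 (lt_trans tc).
apply: (@integrableMl_bounded _ _ _ _ (c ^+ n / n`!%:R)) => //.
  apply: measurable_funM => //; apply: measurable_funX; exact: measurable_funB.
move=> t /=; rewrite in_itv/= => /andP[t0 tc].
rewrite normrM normrX [X in _ * X]ger0_norm ?invr_ge0//.
rewrite ler_wpM2r ?invr_ge0// lerXn2r ?nnegrE//; first exact: ltW.
rewrite ger0_norm; lra.
Qed.

(** * Gamma and Beta functions *)

Section Affine.
Context {R : realType}.
Variables (r c : R).
Hypothesis r0 : 0 < r.

Let phi : measurableTypeR R -> measurableTypeR R := fun s => r * s + c.

Let mphi : measurable_fun [set: measurableTypeR R] phi.
Proof. by apply: measurable_funD => //; exact: measurable_funM. Qed.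

Let rnn : {nonneg R} := NngNum (ltW r0).

Let nu : {measure set (measurableTypeR R) -> \bar R} :=
  measure_function_pushforward__canonical__measure_function_Measure lebesgue_measure mphi.

(** Uniqueness of Lebesgue measure: on half-open intervals the factor [r] compensates for preimages
    under [phi] being [r] times shorter. *)
Lemma lebesgue_measure_affine (A : set R) : measurable A ->
  lebesgue_measure A = mscale rnn nu A.
Proof.
move: A; apply: lebesgue_measure_unique => _ [[a b] _ <-]/=.
rewrite /mscale/= /pushforward/=.
have -> : phi @^-1` `]a, b] = `](a - c) / r, (b - c) / r]%classic.
  apply/seteqP; split => x /=; rewrite !in_itv/= /phi.
    by rewrite ltr_pdivrMr// ler_pdivlMr// ltrBlDr lerBrDr mulrC.
  by rewrite ltr_pdivrMr// ler_pdivlMr// ltrBlDr lerBrDr mulrC.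
rewrite !lebesgue_measure_itv/= !lte_fin ltr_pM2r ?invr_gt0// ltrBlDr subrK.
case: ifPn => _; last by rewrite mule0.
rewrite -!EFinB -EFinM; congr EFin.
have r1 : r != 0 by rewrite gt_eqF.
by field; rewrite r1.
Qed.

Lemma ge0_integral_affine (D : set R) (f : R -> \bar R) : measurable D ->
  measurable_fun D f -> (forall x, D x -> 0 <= f x)%E ->
  (\int[mu]_(x in D) f x = r%:E * \int[mu]_(s in (fun s => r * s + c)%R @^-1` D) f (r * s + c)%R)%E.
Proof.
move=> mD mf f0.
rewrite (eq_measure_integral (mscale rnn nu)); last first.
  by move=> A mA _; exact: lebesgue_measure_affine.
rewrite ge0_integral_mscale//; congr (_ * _)%E.
by rewrite (ge0_integral_pushforward mphi)// => x; rewrite inE; exact: f0.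
Qed.

End Affine.

Lemma integral_shift (R : realType) (c : R) (D : set R) (f : R -> R) : measurable D ->
  measurable_fun D f ->
  (\int[mu]_(x in D) (f x)%:E = \int[mu]_(s in (fun s => s + c)%R @^-1` D) (f (s + c)%R)%:E)%E.
Proof.
move=> mD mf.
have mf' : measurable_fun D (EFin \o f) by exact/measurable_EFinP.
have e : (fun s : R => 1 * s + c) = (fun s => s + c) by apply/funext => s; rewrite mul1r.
rewrite integralE [RHS]integralE.
have Ap := ge0_integral_affine c ltr01 mD (measurable_funepos mf') (fun x _ => funepos_ge0 _ x).
have An := ge0_integral_affine c ltr01 mD (measurable_funeneg mf') (fun x _ => funeneg_ge0 _ x).
rewrite [X in (X - _)%E = _]Ap [X in (_ - X)%E = _]An.
rewrite !mul1e e; congr (_ - _)%E; apply: eq_integral => s _; rewrite mul1r; [by rewrite !funeposE|by rewrite !funenegE].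
Qed.

Lemma Rintegral_shift_itv (R : realType) (c a b : R) (f : R -> R) :
  measurable_fun `]a + c, b + c[ f ->
  \int[mu]_(x in `]a + c, b + c[) f x = \int[mu]_(s in `]a, b[) f (s + c).
Proof.
move=> mf; rewrite /Rintegral (@integral_shift _ c)//; congr (fine (integral _ _ _)).
by apply/seteqP; split => x /=; rewrite !in_itv/= !ltrD2r.
Qed.

(** Euler's Beta integral in [\bar R]; finiteness is read off later from that of Gamma. *)
Definition eBeta {R : realType} (a b : R) : \bar R :=
  (\int[mu]_(s in `]0%R, 1%R[) (s `^ (a - 1) * (1 - s) `^ (b - 1))%:E)%E.

Lemma eBeta_ge0 (R : realType) (a b : R) : (0 <= eBeta a b)%E.
Proof. by apply: integral_ge0 => s _; rewrite lee_fin mulr_ge0// powR_ge0. Qed.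

Lemma measurable_powRB (R : realType) (D : set R) (p c : R) :
  measurable_fun D (fun s : R => (s - c) `^ p) /\
  measurable_fun D (fun s : R => (c - s) `^ p).
Proof.
split; apply: (@measurableT_comp _ _ _ _ _ _ (fun x : R => x `^ p)) => //.
  exact: measurable_funB.
exact: measurable_funB.
Qed.

(** Substituting [c = u + (d - u) * s] extracts a power of [d - u] from each factor and one more
    from the measure. *)
Lemma integral_beta_itv (R : realType) (u d a b : R) : u < d ->
  (\int[mu]_(c in `]u, d[) ((c - u) `^ (a - 1) * (d - c) `^ (b - 1))%:E =
   ((d - u) `^ (a + b - 1))%:E * eBeta a b)%E.
Proof.
move=> ud; have du : 0 < d - u by rewrite subr_gt0.
have du0 : d - u != 0 by rewrite gt_eqF.
rewrite (@ge0_integral_affine _ (d - u) u du); last 3 first.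
- exact: measurable_itv.
- apply/measurable_EFinP; apply: measurable_funM; [exact: (measurable_powRB _ _ _).1|exact: (measurable_powRB _ _ _).2].
- by move=> x _; rewrite lee_fin mulr_ge0// powR_ge0.
have -> : (fun s : R => (d - u) * s + u) @^-1` `]u, d[ = `]0, 1[%classic.
  have E x : ((d - u) * x + u < d) = (x < 1) by rewrite -ltrBrDr gtr_pMr.
  by apply/seteqP; split => x /=; rewrite !in_itv/= ltrDr pmulr_rgt0// E.
rewrite /eBeta.
transitivity ((d - u)%:E * \int[mu]_(s in `]0%R, 1%R[) (((d - u) `^ (a + b - 1 - 1))%:E * (s `^ (a - 1) * (1 - s) `^ (b - 1))%:E))%E.
  congr (_ * _)%E; apply: eq_integral => s; rewrite inE/= in_itv/= => /andP[s0 s1].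
  rewrite -EFinM; congr EFin.
  have -> : (d - u) * s + u - u = (d - u) * s by rewrite addrK.
  have -> : d - ((d - u) * s + u) = (d - u) * (1 - s) by ring.
  rewrite !powRM ?subr_ge0 ?ltW//.
  have -> : a + b - 1 - 1 = (a - 1) + (b - 1) by ring.
  by rewrite [in RHS]powRD ?du0 ?implybT// mulrACA.
rewrite ge0_integralZl//; last 3 first.
- apply/measurable_EFinP; apply: measurable_funM; [exact: measurable_funTS|exact: (measurable_powRB _ _ _).2].
- by move=> x _; rewrite lee_fin mulr_ge0// powR_ge0.
- by rewrite lee_fin powR_ge0.
rewrite muleA -EFinM; congr (EFin _ * _)%E.
by rewrite -[X in X * _](powRr1 (ltW du)) -powRD ?du0 ?implybT// [1 + _]addrC subrK.
Qed.

(** * Iterated integrals over a triangle *)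

Lemma real_tonelli (R : realType) (T : R * R -> R) :
  measurable_fun [set: R * R] T -> (forall p, 0 <= T p) ->
  (\int[mu]_s \int[mu]_w (T (s, w))%:E = \int[mu]_w \int[mu]_s (T (s, w))%:E)%E.
Proof.
move=> mT T0.
apply: (@fubini_tonelli _ _ (measurableTypeR R) (measurableTypeR R) R lebesgue_measure lebesgue_measure (EFin \o T)).
  exact/measurable_EFinP.
by move=> p; rewrite lee_fin.
Qed.
(** The integrability claim integrates out the first variable, hence the detour through the function
    with swapped arguments. *)
Lemma real_fubini (R : realType) (T : R * R -> R) :
  measurable_fun [set: R * R] T ->
  (\int[mu]_s \int[mu]_w `|T (s, w)|%:E < +oo)%E ->
  (\int[mu]_s \int[mu]_w (T (s, w))%:E = \int[mu]_w \int[mu]_s (T (s, w))%:E)%E /\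
  mu.-integrable [set: R] (fun w => \int[mu]_s (T (s, w))%:E)%E.
Proof.
move=> mT fin.
have mT' : measurable_fun [set: R * R] (fun p => T (p.2, p.1)).
  by apply: (measurableT_comp (g := fun p : R * R => (p.2, p.1)) mT); exact: measurable_swap.
have intT : (lebesgue_measure \x lebesgue_measure)%E.-integrable
    [set: measurableTypeR R * measurableTypeR R] (EFin \o T).
  by apply/integrable12ltyP => //; exact/measurable_EFinP.
have intT' : (lebesgue_measure \x lebesgue_measure)%E.-integrable
    [set: measurableTypeR R * measurableTypeR R] (EFin \o (fun p => T (p.2, p.1))).
  by apply/integrable21ltyP => //; exact/measurable_EFinP.
split.
  exact: (@Fubini _ _ (measurableTypeR R) (measurableTypeR R) R lebesgue_measure lebesgue_measure (EFin \o T)).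
exact: (@integrable_fubini_F _ _ (measurableTypeR R) (measurableTypeR R) R lebesgue_measure lebesgue_measure
  (EFin \o (fun p => T (p.2, p.1)))).
Qed.

Lemma integral_if (R : realType) (D : set R) (P : pred R) (f : R -> R) :
  (forall x, D x <-> P x) ->
  (\int[mu]_x (if P x then f x else 0%R)%:E = \int[mu]_(x in D) (f x)%:E)%E.
Proof.
move=> DP; rewrite [RHS]integral_mkcond; apply: eq_integral => x _.
rewrite patchE; case: ifPn => [/DP Dx|Px]; first by rewrite mem_set.
by rewrite memNset// => /DP; rewrite (negbTE Px).
Qed.

(** Extension by zero to the plane, so that Fubini's theorem is applied without domains. [J] cuts
    off the outer variable: trivially for Gamma, at [d] for Abel kernels. *)
Definition triangle (R : realType) (J : pred R) (k : R -> R -> R) (p : R * R) : R :=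
  if [&& 0 < p.1, p.1 < p.2 & J p.2] then k p.1 p.2 else 0.

Lemma measurable_triangle (R : realType) (J : pred R) (k : R -> R -> R) :
  measurable_fun [set: R] J ->
  measurable_fun [set: R * R] (fun p => k p.1 p.2) ->
  measurable_fun [set: R * R] (triangle J k).
Proof.
move=> mJ mk; apply: measurable_fun_ifT => //.
apply: measurable_and; first exact: measurable_fun_ltr.
apply: measurable_and; first exact: measurable_fun_ltr.
exact: (@measurableT_comp _ _ _ _ _ _ J).
Qed.

Lemma integral_triangle1 (R : realType) (J : pred R) (k : R -> R -> R) (u : R) :
  0 < u ->
  (\int[mu]_c (triangle J k (u, c))%:E =
   \int[mu]_(c in [set c | (u < c)%R /\ J c]) (k u c)%:E)%E.
Proof.
move=> u0; rewrite -[RHS](integral_if (P := fun c => (u < c) && J c)).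
  by apply: eq_integral => c _; rewrite /triangle/= u0.
by move=> c; split => /andP.
Qed.

Lemma integral_triangle2 (R : realType) (J : pred R) (k : R -> R -> R) (c : R) :
  J c ->
  (\int[mu]_u (triangle J k (u, c))%:E =
   \int[mu]_(u in `]0%R, c[) (k u c)%:E)%E.
Proof.
move=> Jc; rewrite -[RHS](integral_if (P := fun u => (0 < u) && (u < c))).
  by apply: eq_integral => u _; rewrite /triangle/= Jc andbT.
by move=> u /=; rewrite in_itv.
Qed.

Definition eGamma {R : realType} (a : R) : \bar R :=
  (\int[mu]_(t in `]0%R, +oo[) (t `^ (a - 1) * expR (- t))%:E)%E.

Lemma measurable_gamma_integrand (R : realType) (a : R) (D : set R) :
  measurable_fun D (fun t : R => t `^ (a - 1) * expR (- t)).
Proof.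
apply: measurable_funTS; apply: measurable_funM => //.
exact: measurableT_comp.
Qed.

Lemma measurable_powRB2 (R : realType) (p : R) :
  measurable_fun [set: R * R] (fun z => (z.2 - z.1) `^ p).
Proof.
apply: (@measurableT_comp _ _ _ _ _ _ (fun x : R => x `^ p)) => //.
exact: measurable_funB.
Qed.

(** The kernel [k] is integrated over [0 < s < w] in both orders. Integrating in [w] first, with
    [w = s + t], separates the two Gamma integrals; integrating in [s] first leaves a Beta integral
    on []0, w[]. *)
Lemma eGamma_eBeta (R : realType) (a b : R) :
  (eGamma a * eGamma b = eGamma (a + b) * eBeta a b :> \bar R)%E.
Proof.
pose k (s w : R) := s `^ (a - 1) * (w - s) `^ (b - 1) * expR (- w).
pose T := triangle predT k.
have k0 s w : 0 <= k s w by rewrite /k !mulr_ge0// ?powR_ge0// expR_ge0.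
have mk : measurable_fun [set: R * R] (fun p => k p.1 p.2).
  apply: measurable_funM; first apply: measurable_funM.
  - by apply: (@measurableT_comp _ _ _ _ _ _ (fun x : R => x `^ (a - 1))).
  - exact: measurable_powRB2.
  - by apply: measurableT_comp => //; apply: measurableT_comp.
have mT : measurable_fun [set: R * R] T by apply: measurable_triangle => //; exact: measurable_cst.
have T0 p : 0 <= T p by rewrite /T /triangle; case: ifPn.
have mo : measurable (`]0%R, +oo[ : set R) by exact: measurable_itv.
have g0 (c t : R) : (0 <= (t `^ (c - 1) * expR (- t))%:E)%E.
  by rewrite lee_fin mulr_ge0 ?powR_ge0// expR_ge0.
transitivity (\int[mu]_s \int[mu]_w (T (s, w))%:E)%E.
  transitivity (\int[mu]_(s in `]0%R, +oo[) \int[mu]_w (T (s, w))%:E)%E; last first.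
    rewrite [LHS]integral_mkcond; apply: eq_integral => s _; rewrite patchE; case: ifPn => // s0.
    rewrite /T /triangle/=.
    have -> : (0 < s) = false.
      by apply/negP => s0'; move: s0; rewrite notin_setE/= in_itv/= s0'.
    by rewrite integral0.
  rewrite muleC -ge0_integralZl//; last 2 first.
  - by apply/measurable_EFinP; exact: measurable_gamma_integrand.
  - by apply: integral_ge0 => t _.
  apply: eq_integral => s; rewrite inE/= in_itv/= andbT => s0.
  rewrite integral_triangle1//.
  have -> : [set c | s < c /\ predT c] = `]s, +oo[%classic.
    by apply/seteqP; split => c /=; rewrite in_itv/= andbT => //; case.
  rewrite (@ge0_integral_affine _ 1 s ltr01)//; last 2 first.
  - apply/measurable_EFinP; apply: measurable_funM; first apply: measurable_funM => //.
      exact: (measurable_powRB _ _ _).1.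
    by apply: measurableT_comp => //; apply: measurableT_comp.
  - by move=> x _; rewrite lee_fin.
  rewrite mul1e.
  have -> : (fun t : R => 1 * t + s) @^-1` `]s, +oo[ = `]0, +oo[%classic.
    by apply/seteqP; split => c /=; rewrite !in_itv/= mul1r ltrDr.
  rewrite muleC -ge0_integralZl//; last first.
    by apply/measurable_EFinP; exact: measurable_gamma_integrand.
  apply: eq_integral => t _; rewrite /k mul1r addrK -EFinM; congr EFin.
  rewrite opprD expRD; ring.
transitivity (\int[mu]_w \int[mu]_s (T (s, w))%:E)%E.
  exact: real_tonelli.
transitivity (\int[mu]_(w in `]0%R, +oo[) \int[mu]_s (T (s, w))%:E)%E.
  rewrite [RHS]integral_mkcond; apply: eq_integral => w _; rewrite patchE; case: ifPn => // w0.
  apply: integral0_eq => s _ /=; rewrite /T /triangle/= andbT; case: ifPn => // /andP[s0 sw].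
  by move: w0; rewrite notin_setE/= in_itv/= (lt_trans s0 sw).
rewrite muleC -ge0_integralZl//; last 2 first.
- by apply/measurable_EFinP; exact: measurable_gamma_integrand.
- exact: eBeta_ge0.
apply: eq_integral => w; rewrite inE/= in_itv/= andbT => w0.
rewrite integral_triangle2//.
transitivity ((expR (- w))%:E * \int[mu]_(u in `]0%R, w[) ((u - 0) `^ (a - 1) * (w - u) `^ (b - 1))%:E)%E.
  rewrite -ge0_integralZl//; last 2 first.
  - apply/measurable_EFinP; apply: measurable_funM; [exact: (measurable_powRB _ _ _).1|exact: (measurable_powRB _ _ _).2].
  - by move=> x _; rewrite lee_fin mulr_ge0// powR_ge0.
  by apply: eq_integral => u _; rewrite -EFinM subr0 /k; congr EFin; ring.
rewrite integral_beta_itv// subr0 muleA -EFinM muleC; congr (_ * EFin _)%E; ring.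
Qed.

Lemma integral_powR01_fin (R : realType) (a : R) : 0 < a ->
  (\int[mu]_(t in `]0%R, 1%R[) (t `^ (a - 1))%:E < +oo)%E.
Proof.
move=> a0.
(* The shift by 2 keeps the left end point below 1. On each piece the power is bounded, and its
   primitive [t ^ a / a] yields the uniform bound [1 / a]. *)
pose F (n : nat) := `]n.+2%:R^-1, 1[%classic : set R.
have n2 (n : nat) : 0 < n.+2%:R^-1 :> R by rewrite invr_gt0.
have n21 (n : nat) : n.+2%:R^-1 < 1 :> R by rewrite invf_lt1// ltr1n.
have ndF : {homo F : n m / (n <= m)%N >-> (n <= m)%O}.
  move=> n m nm; rewrite subsetEset; apply: subset_itv; rewrite bnd_simp//.
  by rewrite lef_pV2 ?posrE// ler_nat !ltnS.
have UF : `]0%R, 1%R[%classic = \bigcup_n F n.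
  apply/seteqP; split => x /=.
    rewrite in_itv/= => /andP[x0 x1]; exists (Num.truncn x^-1) => //.
    rewrite /F/= in_itv/= x1 andbT -[ltRHS]invrK ltf_pV2 ?posrE ?invr_gt0//.
    apply: lt_trans (truncnS_gt _) _; by rewrite ltr_nat.
  by move=> [n _]; rewrite /F/= !in_itv/= => /andP[x0 ->]; rewrite (lt_trans (n2 n)).
have mp (D : set R) : measurable_fun D (fun t : R => (t `^ (a - 1))%:E).
  by apply/measurable_EFinP; exact: measurable_funTS.
rewrite UF.
have cv : (\int[mu]_(t in F n) (t `^ (a - 1))%:E)%E @[n --> \oo] -->
    (\int[mu]_(t in \bigcup_n F n) (t `^ (a - 1))%:E)%E.
  apply: ge0_nondecreasing_set_cvg_integral => //.
  - by move=> i; exact: measurable_itv.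
  - by move=> i; exact: mp.
  - by move=> i x _; rewrite lee_fin powR_ge0.
apply: (@le_lt_trans _ _ (a^-1)%:E); last exact: ltry.
apply: (cvge_to_le cv); apply: nearW => n.
have intn : mu.-integrable (F n) (EFin \o (fun t : R => t `^ (a - 1))).
  apply: (@integrable_le_EFin _ _ _ (cst n.+2%:R)); [exact: measurable_itv|exact: measurable_funTS| |exact: integrable_cst_itv].
  move=> t; rewrite /F/= in_itv/= => /andP[tn t1].
  have t0 : 0 < t by rewrite (lt_trans (n2 n)).
  rewrite ger0_norm ?powR_ge0//; apply: (@le_trans _ _ (t `^ (-1))).
    by rewrite ger_powR ?t0 ?ltW//; lra.
  by rewrite powR_inv1 ?(ltW t0)// -[leRHS]invrK lef_pV2 ?posrE ?invr_gt0// ltW.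
have d (t : R) : n.+2%:R^-1 <= t -> is_derive t 1 (fun t : R => a^-1 * t `^ a) (t `^ (a - 1)).
  move=> t0; have : is_derive t 1 (a^-1 \*: (fun t : R => t `^ a)) (a^-1 *: (a * t `^ (a - 1))).
    by apply: is_deriveZ; apply: is_derive1_powR; exact: lt_le_trans t0.
  by rewrite /GRing.scale/= mulKf ?gt_eqF.
have := @Rintegral_derive R (fun t => a^-1 * t `^ a) (fun t => t `^ (a - 1)) (n.+2%:R^-1) 1 (n21 n).
have cP : {within `[n.+2%:R^-1, 1], continuous (fun t : R => a^-1 * t `^ a)}.
  by apply: derivable_within_continuous => t; rewrite in_itv/= => /andP[/d dt _]; exact: ex_derive.
move=> /(_ cP _ intn) H.
have {}H : \int[mu]_(x in `]n.+2%:R^-1, 1[) x `^ (a - 1) = a^-1 * 1 `^ a - a^-1 * n.+2%:R^-1 `^ a.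
  by apply: H => t; rewrite in_itv/= => /andP[/ltW/d].
rewrite -[leLHS]fineK; last by apply: (integrable_fin_num _ intn); exact: measurable_itv.
by rewrite lee_fin [leLHS]H powR1 mulr1 gerBl mulr_ge0 ?powR_ge0// invr_ge0 ltW.
Qed.

(** Below 1 the power dominates; from 1 on, a multiple of the exponential density of rate 1/2, whose
    total mass is 1. *)
Lemma eGamma_fin (R : realType) (a : R) : 0 < a -> (eGamma a < +oo)%E.
Proof.
move=> a0; pose f (t : R) := t `^ (a - 1) * expR (- t).
have f0 t : 0 <= f t by rewrite /f mulr_ge0 ?powR_ge0// expR_ge0.
have mf (D : set R) : measurable_fun D (fun t => (f t)%:E).
  by apply/measurable_EFinP; exact: measurable_gamma_integrand.
have m01 : measurable (`]0, 1[ : set R) by exact: measurable_itv.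
have m1y : measurable (`[1, +oo[ : set R) by exact: measurable_itv.
rewrite /eGamma.
have -> : `]0%R, +oo[%classic = `]0%R, 1%R[%classic `|` `[1%R, +oo[%classic :> set R.
  by rewrite -itv_bndbnd_setU// bnd_simp.
rewrite ge0_integral_setU//=; last 3 first.
- exact: mf.
- by move=> t _; rewrite lee_fin f0.
- by apply: lt_disjoint => s t; rewrite !in_itv/= andbT => /andP[_ s1]; exact: lt_le_trans.
apply: lte_add_pinfty.
  apply: le_lt_trans (integral_powR01_fin a0); apply: ge0_le_integral => //.
  - by move=> t _; rewrite lee_fin f0.
  - exact: mf.
  - by apply/measurable_EFinP; exact: measurable_funTS.
  - move=> t /=; rewrite in_itv/= => /andP[t0 t1]; rewrite lee_fin /f.
    by rewrite ler_piMr ?powR_ge0// -expR0 ler_expR oppr_le0 ltW.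
(* As [m > a - 1], the power is at most [t ^ m]. The [m]-th power of [z <= exp z] at [z = t / (2 m)]
   gives [t ^ m <= (2 m) ^ m * exp (t / 2)]; the leading 2 in [C] offsets the factor 1/2 of the
   density. *)
pose m := (Num.truncn a).+1.
have m0 : 0 < m%:R :> R by rewrite ltr0n.
pose C : R := 2 * (2 * m%:R) ^+ m.
have C0 : 0 <= C by rewrite /C mulr_ge0// exprn_ge0// mulr_ge0.
have mpdf (D : set R) : measurable_fun D (fun t : R => (exponential_pdf 2^-1 t)%:E).
  by apply/measurable_EFinP; apply: measurable_funTS; exact: measurable_exponential_pdf.
have h2 : 0 < 2^-1 :> R by rewrite invr_gt0.
have pdf0 (t : R) : 0 <= exponential_pdf 2^-1 t by apply: exponential_pdf_ge0; exact: ltW.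
have bnd (t : R) : 1 <= t -> f t <= C * exponential_pdf 2^-1 t.
  move=> t1; rewrite /f.
  have t0 : 0 <= t by rewrite (le_trans ler01).
  rewrite exponential_pdfE// /C.
  have -> : expR (- t) = (expR (t / 2))^-1 * expR (- (2^-1) * t).
    by rewrite -expRN -expRD; congr expR; field.
  have H : t `^ (a - 1) <= (2 * m%:R) ^+ m * expR (t / 2).
    apply: (@le_trans _ _ (t ^+ m)).
      rewrite -powR_mulrn// ler_powR//.
      by have := truncnS_gt a; rewrite -/m; lra.
    have -> : expR (t / 2) = expR (t / (2 * m%:R)) ^+ m.
      by rewrite -expRM_natl; congr expR; field; rewrite gt_eqF.
    rewrite -exprMn lerXn2r ?nnegrE ?mulr_ge0 ?expR_ge0//.
    have mm : 0 < 2 * m%:R :> R by rewrite mulr_gt0.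
    rewrite -ler_pdivrMl// mulrC (le_trans _ (expR_ge1Dx _))//; lra.
  rewrite [leRHS](_ : _ = (2 * m%:R) ^+ m * expR (- 2^-1 * t)); last by field.
  by rewrite mulrA ler_wpM2r ?expR_ge0// ler_pdivrMr ?expR_gt0.
apply: (@le_lt_trans _ _ (\int[mu]_(t in `[1%R, +oo[) (C%:E * (exponential_pdf 2^-1 t)%:E))%E).
  apply: ge0_le_integral => //.
  - by move=> t _; rewrite lee_fin f0.
  - exact: mf.
  - by apply: emeasurable_funM => //; exact: mpdf.
  - by move=> t /=; rewrite in_itv/= andbT => t1; rewrite -EFinM lee_fin bnd.
rewrite ge0_integralZl//; last 2 first.
- exact: mpdf.
- by move=> t _; rewrite lee_fin.
apply: lte_mul_pinfty => //; apply: (@le_lt_trans _ _ (\int[mu]_t (exponential_pdf 2^-1 t)%:E)%E).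
  apply: ge0_subset_integral => //.
    exact: mpdf.
  by move=> t _; rewrite lee_fin.
by rewrite integral_exponential_pdf// ltry.
Qed.

(** On []1, 2[] the integrand is at least [exp (- 2) / 2], because [t ^ (a - 1) >= 1 / t]. *)
Lemma eGamma_gt0 (R : realType) (a : R) : 0 < a -> (0 < eGamma a)%E.
Proof.
move=> a0.
have m1 : measurable (`]1, 2[ : set R) by exact: measurable_itv.
have m0 : measurable (`]0, +oo[ : set R) by exact: measurable_itv.
apply: (@lt_le_trans _ _ (\int[mu]_(t in `]1%R, 2%R[) (2^-1 * expR (- 2))%:E)%E).
  rewrite integral_cst// [X in (_ * X)%E]lebesgue_measure_itv/= lte_fin ifT; last by lra.
  by rewrite -EFinB -EFinM lte_fin mulr_gt0 ?mulr_gt0 ?invr_gt0 ?expR_gt0//; lra.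
apply: (@le_trans _ _ (\int[mu]_(t in `]1%R, 2%R[) (t `^ (a - 1) * expR (- t))%:E)%E).
  apply: ge0_le_integral => //.
  - by apply/measurable_EFinP; exact: measurable_gamma_integrand.
  - move=> t /=; rewrite in_itv/= => /andP[t1 t2]; rewrite lee_fin.
    apply: ler_pM; rewrite ?expR_ge0//.
      apply: (@le_trans _ _ (t `^ (-1))).
        by rewrite powR_inv1 ?lef_pV2 ?posrE//; lra.
      by rewrite ler_powR//; lra.
    by rewrite ler_expR; lra.
apply: ge0_subset_integral => //.
- by apply/measurable_EFinP; exact: measurable_gamma_integrand.
- by move=> x _; rewrite lee_fin mulr_ge0 ?powR_ge0// expR_ge0.
- by move=> x /=; rewrite !in_itv/= => /andP[x1 _]; rewrite (lt_trans _ x1).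
Qed.

Lemma Gamma_gt0 (R : realType) (a : R) : 0 < a -> 0 < Gamma a.
Proof.
move=> a0; apply: fine_gt0; apply/andP; split; first exact: eGamma_gt0.
exact: eGamma_fin.
Qed.

Lemma eGammaE (R : realType) (a : R) : 0 < a -> eGamma a = (Gamma a)%:E.
Proof.
by move=> a0; rewrite /Gamma /Rintegral fineK// ge0_fin_numE ?eGamma_fin// ltW// eGamma_gt0.
Qed.

(** An infinite Beta value, multiplied by the positive [Gamma (a + b)], would contradict the
    finiteness of [Gamma a * Gamma b]. *)
Lemma eBetaE (R : realType) (a b : R) : 0 < a -> 0 < b ->
  eBeta a b = (Gamma a * Gamma b / Gamma (a + b))%:E.
Proof.
move=> a0 b0; have ab0 : 0 < a + b by rewrite addr_gt0.
have := eGamma_eBeta a b; rewrite !eGammaE//.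
have G0 := Gamma_gt0 ab0.
have : (0 <= eBeta a b)%E by exact: eBeta_ge0.
case: (eBeta a b) => [r| |]//= _; last by rewrite mulry gtr0_sg// mul1e.
by rewrite -!EFinM => -[->]; rewrite mulrAC divff ?mul1r// gt_eqF.
Qed.

Lemma Gamma1 (R : realType) : Gamma 1 = 1 :> R.
Proof.
apply: EFin_inj; rewrite -eGammaE// -(@integral_exponential_pdf R 1)//.
rewrite /eGamma integral_itv_obnd_cbnd; last by apply/measurable_EFinP; exact: measurable_gamma_integrand.
rewrite integral_mkcond; apply: eq_integral => t _; rewrite patchE.
case: ifPn; rewrite ?inE ?notin_setE/= in_itv/= andbT => t0.
  by rewrite exponential_pdfE// subrr powRr0 !mul1r mulN1r.
by rewrite lt0_exponential_pdf// ltNge; apply/negP.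
Qed.

(** The functional equation is drawn from [B(n + 1, 1) = 1 / (n + 1)], an integral over a bounded
    interval, instead of integrating by parts on the half-line. *)
Lemma Gamma_nat (R : realType) (n : nat) : Gamma (n%:R + 1) = n`!%:R :> R.
Proof.
elim: n => [|n IH]; first by rewrite add0r Gamma1.
have n0 : 0 < n%:R + 1 :> R by rewrite ltr_wpDl.
have n1 : n.+1%:R != 0 :> R by rewrite pnatr_eq0.
have : eBeta (n%:R + 1) 1 = (n.+1%:R^-1)%:E :> \bar R.
  rewrite /eBeta addrK subrr.
  transitivity (\int[mu]_(s in `]0%R, 1%R[) ((s : R) ^+ n)%:E)%E.
    apply: eq_integral => s; rewrite inE/= in_itv/= => /andP[s0 _].
    by rewrite powRr0 mulr1 powR_mulrn// ltW.
  have intn : mu.-integrable `]0, 1[ (EFin \o (fun s : R => s ^+ n)).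
    apply: (@integrable_le_EFin _ _ _ (cst 1)) => //; last exact: integrable_cst_itv.
    move=> t /=; rewrite in_itv/= => /andP[t0 t1].
    by rewrite normrX exprn_ile1 ?normr_ge0// gtr0_norm// ltW.
  have d (t : R) : is_derive t 1 (fun t : R => n.+1%:R^-1 * t ^+ n.+1) (t ^+ n).
    have : is_derive t 1 (n.+1%:R^-1 \*: (@id R ^+ n.+1)) (n.+1%:R^-1 *: ((n.+1%:R * t ^+ n) *: 1)).
      by apply: is_deriveZ; exact: is_deriveX.
    rewrite (_ : _ \*: _ = fun t : R => n.+1%:R^-1 * t ^+ n.+1); last first.
      by apply/funext => s; rewrite /= exprfctE.
    by rewrite /GRing.scale/= mulr1 mulKf.
  have H : \int[mu]_(t in `]0, 1[) t ^+ n = n.+1%:R^-1 * 1 ^+ n.+1 - n.+1%:R^-1 * 0 ^+ n.+1 :> R.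
    apply: (@Rintegral_derive R (fun t => n.+1%:R^-1 * t ^+ n.+1)) => //.
    by apply: derivable_within_continuous => t _; exact: ex_derive.
  rewrite -[LHS]fineK; last by apply: (integrable_fin_num _ intn); exact: measurable_itv.
  by rewrite [fine _]H expr1n mulr1 exprS mul0r mulr0 subr0.
rewrite eBetaE// Gamma1 mulr1 IH => -[].
have := Gamma_gt0 (addr_gt0 n0 ltr01); rewrite natr1 => G0.
move=> /(congr1 (fun z => z * Gamma (n.+1%:R + 1) * n.+1%:R)).
rewrite divfK ?gt_eqF// mulrAC mulVf// mul1r factS natrM => <-; exact: mulrC.
Qed.

Lemma integrable_EFin_fin (R : realType) (D : set R) (f : R -> R) : measurable D ->
  mu.-integrable D (EFin \o f) -> (\int[mu]_(x in D) (f x)%:E)%E \is a fin_num.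
Proof. by move=> mD; exact: integrable_fin_num. Qed.

Lemma EFin_Rintegral (R : realType) (D : set R) (f : R -> R) : measurable D ->
  mu.-integrable D (EFin \o f) ->
  (\int[mu]_(x in D) f x)%:E = (\int[mu]_(x in D) (f x)%:E)%E.
Proof. by move=> mD intf; rewrite /Rintegral fineK// integrable_EFin_fin. Qed.

Lemma Rintegral_scale (R : realType) (D : set R) (k : R) (f : R -> R) : measurable D ->
  mu.-integrable D (EFin \o f) ->
  \int[mu]_(x in D) (k * f x) = k * \int[mu]_(x in D) f x.
Proof. by move=> mD intf; rewrite RintegralZl. Qed.

Lemma integrable_beta_itv (R : realType) (u d a b : R) : 0 < a -> 0 < b -> u < d ->
  mu.-integrable `]u, d[ (EFin \o (fun c => (c - u) `^ (a - 1) * (d - c) `^ (b - 1))).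
Proof.
move=> a0 b0 ud; apply/integrableP; split.
  by apply/measurable_EFinP; apply: measurable_funM; [exact: (measurable_powRB _ _ _).1|exact: (measurable_powRB _ _ _).2].
apply: (@le_lt_trans _ _ ((d - u) `^ (a + b - 1) * (Gamma a * Gamma b / Gamma (a + b)))%:E); last exact: ltry.
rewrite EFinM -eBetaE// -integral_beta_itv// le_eqVlt; apply/orP; left; apply/eqP.
by apply: eq_integral => c _; rewrite /= ger0_norm// mulr_ge0 ?powR_ge0.
Qed.

Lemma Rintegral_beta_itv (R : realType) (u d a b : R) : 0 < a -> 0 < b -> u < d ->
  \int[mu]_(c in `]u, d[) ((c - u) `^ (a - 1) * (d - c) `^ (b - 1)) =
  (d - u) `^ (a + b - 1) * (Gamma a * Gamma b / Gamma (a + b)).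
Proof.
move=> a0 b0 ud; apply: EFin_inj.
rewrite EFinM -eBetaE// -integral_beta_itv// /Rintegral fineK//.
exact: integrable_fin_num (integrable_beta_itv a0 b0 ud).
Qed.

(** Semigroup law of fractional integration: once the order is exchanged, the inner integral is a
    Beta integral. From [1 <= a + b] the composed weight is bounded, so integrability of [w] gives
    absolute convergence. The inner integrals are required to exist at every [c]; Fubini's theorem
    would give them only for almost all [c]. *)
Lemma abel_fubini (R : realType) (a b d : R) (w : R -> R) :
  0 < a -> 0 < b -> 1 <= a + b -> 0 < d ->
  mu.-integrable `]0, d[ (EFin \o w) ->
  (forall c, 0 < c < d -> mu.-integrable `]0, c[ (EFin \o (fun u => w u * (c - u) `^ (a - 1)))) ->
  let Phi c := (d - c) `^ (b - 1) * \int[mu]_(u in `]0, c[) (w u * (c - u) `^ (a - 1)) in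
  mu.-integrable `]0, d[ (EFin \o Phi) /\
  \int[mu]_(c in `]0, d[) Phi c =
    Gamma a * Gamma b / Gamma (a + b) * \int[mu]_(u in `]0, d[) (w u * (d - u) `^ (a + b - 1)).
Proof.
move=> a0 b0 ab1 d0 intw intwc Phi.
set B := Gamma a * Gamma b / Gamma (a + b).
have B0 : 0 <= B by rewrite /B divr_ge0 ?mulr_ge0// ltW// Gamma_gt0// addr_gt0.
have mD : measurable (`]0, d[ : set R) by exact: measurable_itv.
have hD (c : R) : `]0, d[%classic c <-> 0 < c < d by split; rewrite /= in_itv.
(* [w] is measurable only on []0, d[]; its extension by zero makes the kernel measurable on the
   plane. *)
pose W := w \_ `]0, d[%classic.
have WE u : 0 < u < d -> W u = w u.
  by move=> ud; rewrite /W patchE mem_set//= in_itv.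
have mW : measurable_fun [set: R] W.
  by apply/(measurable_restrictT w mD); exact: measurable_integrable.
pose k (u c : R) := W u * ((c - u) `^ (a - 1) * (d - c) `^ (b - 1)).
pose J : pred R := fun c => c < d.
pose T := triangle J k.
have mk : measurable_fun [set: R * R] (fun p => k p.1 p.2).
  apply: measurable_funM; first exact: (measurableT_comp mW).
  apply: measurable_funM; first exact: measurable_powRB2.
  apply: (@measurableT_comp _ _ _ _ _ _ (fun x : R => x `^ (b - 1))) => //.
  exact: measurable_funB.
have mJ : measurable_fun [set: R] J by exact: measurable_fun_ltr.
have mT : measurable_fun [set: R * R] T by exact: measurable_triangle.
have int_wd : mu.-integrable `]0, d[ (EFin \o (fun u => w u * (d - u) `^ (a + b - 1))).
  apply: (@integrableMl_bounded _ _ _ _ (d `^ (a + b - 1))) => //.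
    exact: (measurable_powRB _ _ _).2.
  move=> u /=; rewrite in_itv/= => /andP[u0 ud].
  by rewrite ger0_norm ?powR_ge0// ge0_ler_powR ?nnegrE//; lra.
have Jset u : [set c | u < c /\ J c] = `]u, d[%classic.
  by apply/seteqP; split => c /=; rewrite in_itv/= => /andP.
have Tout1 u c : ~~ (0 < u < d) -> T (u, c) = 0.
  move=> ud; rewrite /T /triangle/=; case: ifPn => // /and3P[u0 uc cd].
  by move: ud; rewrite u0 (lt_trans uc cd).
have Tout2 u c : ~~ (0 < c < d) -> T (u, c) = 0.
  move=> ud; rewrite /T /triangle/=; case: ifPn => // /and3P[u0 uc cd].
  by move: ud cd; rewrite (lt_trans u0 uc) /J /= => /negP.
have T1 u : (\int[mu]_c (T (u, c))%:E =
    (if 0 < u < d then B * (w u * (d - u) `^ (a + b - 1)) else 0)%:E)%E.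
  case: ifPn => ud; last by apply: integral0_eq => c _; rewrite Tout1.
  case/andP: (ud) => u0 u1.
  rewrite integral_triangle1// Jset /k; under eq_integral do rewrite EFinM.
  rewrite integralZl//; last exact: integrable_beta_itv.
  by rewrite integral_beta_itv// eBetaE// -!EFinM WE// -/B; congr EFin; ring.
have T1n u : (\int[mu]_c `|T (u, c)|%:E =
    (if 0 < u < d then B * (`|w u| * (d - u) `^ (a + b - 1)) else 0)%:E)%E.
  case: ifPn => ud; last by apply: integral0_eq => c _; rewrite Tout1// normr0.
  case/andP: (ud) => u0 u1.
  transitivity (\int[mu]_c (triangle J (fun u c => `|W u| * ((c - u) `^ (a - 1) * (d - c) `^ (b - 1))) (u, c))%:E)%E.
    apply: eq_integral => c _; rewrite /T /triangle/=; case: ifPn; rewrite ?normr0//.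
    by rewrite /k normrM [X in _ * X]ger0_norm// mulr_ge0 ?powR_ge0.
  rewrite integral_triangle1// Jset; under eq_integral do rewrite EFinM.
  rewrite integralZl//; last exact: integrable_beta_itv.
  by rewrite integral_beta_itv// eBetaE// -!EFinM WE// -/B; congr EFin; ring.
have T2 c : (\int[mu]_u (T (u, c))%:E = (if 0 < c < d then Phi c else 0)%:E)%E.
  case: ifPn => cd; last by apply: integral0_eq => u _; rewrite Tout2.
  case/andP: (cd) => c0 c1.
  rewrite integral_triangle2//.
  transitivity (\int[mu]_(u in `]0%R, c[) (((d - c) `^ (b - 1))%:E * (w u * (c - u) `^ (a - 1))%:E))%E.
    apply: eq_integral => u; rewrite inE/= in_itv/= => /andP[u0 uc].
    by rewrite -EFinM /k WE ?u0 ?(lt_trans uc c1)//; congr EFin; ring.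
  rewrite integralZl//; last exact: intwc.
  rewrite /Phi EFinM /Rintegral fineK//.
  exact: integrable_fin_num (intwc _ cd).
have [|FE intF] := real_fubini mT.
  under eq_integral do rewrite T1n.
  rewrite (@integral_if _ `]0, d[); last by move=> u /=; rewrite in_itv.
  have : mu.-integrable `]0, d[ (EFin \o (fun u => B * `|w u * (d - u) `^ (a + b - 1)|)).
    by apply: integrableZ_EFin => //; exact: integrable_norm int_wd.
  move=> /(integrable_EFin_fin mD); rewrite fin_numElt => /andP[_].
  apply: le_lt_trans; rewrite le_eqVlt; apply/orP; left; apply/eqP.
  by apply: eq_integral => u _; rewrite /= normrM (ger0_norm (powR_ge0 _ _)).
have intPhi : mu.-integrable `]0, d[ (EFin \o Phi).
  have : mu.-integrable `]0, d[ (fun c => \int[mu]_u (T (u, c))%:E)%E.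
    apply: (integrableS _ _ _ intF); [exact: measurableT|exact: mD|exact: subsetT].
  apply: eq_integrable; first exact: mD.
  move=> c; rewrite inE/= in_itv/= => cd.
  by rewrite T2 cd.
split; first exact: intPhi.
have int_Bwd := integrableZ_EFin B mD int_wd.
rewrite -(Rintegral_scale B mD int_wd); apply: EFin_inj.
transitivity (\int[mu]_c \int[mu]_u (T (u, c))%:E)%E.
  rewrite (EFin_Rintegral mD intPhi).
  transitivity (\int[mu]_c (if 0 < c < d then Phi c else 0%R)%:E)%E.
    exact: (esym (integral_if Phi hD)).
  by apply: eq_integral => c _; rewrite T2.
rewrite -FE; transitivity (\int[mu]_u (if 0 < u < d then B * (w u * (d - u) `^ (a + b - 1)) else 0%R)%R%:E)%E.
  by apply: eq_integral => u _; rewrite T1.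
rewrite (EFin_Rintegral mD int_Bwd).
exact: (integral_if (fun u => B * (w u * (d - u) `^ (a + b - 1))) hD).
Qed.

(** * Inversion of Abel's integral equation *)

Lemma itvoo_subset (R : realType) (a b c d : R) : c <= a -> b <= d ->
  `]a, b[ `<=` (`]c, d[ : set R).
Proof. by move=> ca bd; apply: subset_itv; rewrite bnd_simp. Qed.

Lemma integrable_sub_itv (R : realType) (f : R -> R) (a b c d : R) : c <= a -> b <= d ->
  mu.-integrable `]c, d[ (EFin \o f) -> mu.-integrable `]a, b[ (EFin \o f).
Proof.
move=> ca bd; apply: integrableS; [exact: measurable_itv|exact: measurable_itv|].
exact: itvoo_subset.
Qed.

Lemma integrable_mul_powR (R : realType) (f : R -> R) (c p : R) : 0 <= p ->
  mu.-integrable `]0, c[ (EFin \o f) ->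
  mu.-integrable `]0, c[ (EFin \o (fun u => f u * (c - u) `^ p)).
Proof.
move=> p0; apply: (@integrableMl_bounded _ _ _ _ (c `^ p)) => //.
  exact: (measurable_powRB _ _ _).2.
move=> u /=; rewrite in_itv/= => /andP[u0 uc].
by rewrite ger0_norm ?powR_ge0// ge0_ler_powR ?nnegrE//; lra.
Qed.

(* [Gamma p] times the fractional integral of order [p - 1] of a function
   with value [F0] at [0] and derivative [Fp]. *)
Definition fracP {R : realType} (F0 : R) (Fp : R -> R) (p c : R) : R :=
  F0 * c `^ (p - 1) + \int[mu]_(u in `]0, c[) (Fp u * (c - u) `^ (p - 1)).

(** The [F0] term is a Beta integral and the other an instance of [abel_fubini], with the same
    constant. The choice [b = 1] is plain integration. *)
Lemma fracP_conv (R : realType) (F0 : R) (Fp : R -> R) (p b d : R) :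
  1 <= p -> 0 < b -> 0 < d -> mu.-integrable `]0, d[ (EFin \o Fp) ->
  mu.-integrable `]0, d[ (EFin \o (fun c => (d - c) `^ (b - 1) * fracP F0 Fp p c)) /\
  \int[mu]_(c in `]0, d[) ((d - c) `^ (b - 1) * fracP F0 Fp p c) =
    Gamma p * Gamma b / Gamma (p + b) * fracP F0 Fp (p + b) d.
Proof.
move=> p1 b0 d0 intF.
have p0 : 0 < p by lra.
have pb : 1 <= p + b by lra.
have mD : measurable (`]0, d[ : set R) by exact: measurable_itv.
have intc c : 0 < c < d -> mu.-integrable `]0, c[ (EFin \o (fun u => Fp u * (c - u) `^ (p - 1))).
  move=> /andP[c0 cd]; apply: integrable_mul_powR; first by lra.
  by apply: integrable_sub_itv intF => //; exact: ltW.
have [int1 eq1] := abel_fubini p0 b0 pb d0 intF intc.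
set A := (fun c => (d - c) `^ (b - 1) * \int[mu]_(u in `]0, c[) (Fp u * (c - u) `^ (p - 1))) in int1 eq1.
pose B c := (c - 0) `^ (p - 1) * (d - c) `^ (b - 1).
have int2 : mu.-integrable `]0, d[ (EFin \o B) by exact: integrable_beta_itv.
have int2F := integrableZ_EFin F0 mD int2.
have E c : F0 * B c + A c = (d - c) `^ (b - 1) * fracP F0 Fp p c.
  by rewrite /A /B /fracP subr0; ring.
have intS := integrableD_EFin mD int2F int1.
have eB : \int[mu]_(c in `]0, d[) B c = (d - 0) `^ (p + b - 1) * (Gamma p * Gamma b / Gamma (p + b)).
  exact: Rintegral_beta_itv.
have eS : \int[mu]_(c in `]0, d[) (F0 * B c + A c) =
    \int[mu]_(c in `]0, d[) (F0 * B c) + \int[mu]_(c in `]0, d[) A c.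
  by move: int2F int1 mD; clear; move=> ? ? ?; rewrite RintegralD.
have fE : (fun c => F0 * B c + A c) = (fun c => (d - c) `^ (b - 1) * fracP F0 Fp p c).
  by apply/funext => c; exact: E.
rewrite fE in intS eS; split; first exact: intS.
rewrite eS (Rintegral_scale F0 mD int2) eB eq1 subr0 /fracP; ring.
Qed.

Lemma measurable_div_powR (R : realType) (Fp : R -> R) (q h : R) :
  measurable_fun `]0, h[ (fun t => Fp t * (h - t) `^ q) -> measurable_fun `]0, h[ Fp.
Proof.
move=> mF.
apply: (@eq_measurable_fun _ _ _ _ _ (fun t => Fp t * (h - t) `^ q * (h - t) `^ (- q))).
  move=> t; rewrite inE/= in_itv/= => /andP[t0 th].
  have ht : 0 < h - t by rewrite subr_gt0.
  by rewrite powRN mulfK// gt_eqF// powR_gt0.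
by apply: measurable_funM => //; exact: (measurable_powRB _ _ _).2.
Qed.

Lemma powR_continuous (R : realType) (q x : R) : 0 < x -> {for x, continuous (fun z : R => z `^ q)}.
Proof. by move=> x0; apply: is_derive_continuous (is_derive1_powR q x0). Qed.

(** For [c < h] the weight [(c - t) ^ (p - 1)] is at most [(h - t) ^ (p - 1)], as [p >= 1]; the
    integrand at [h] is therefore the dominating function. *)
Lemma fracP_cvg_left (R : realType) (F0 : R) (Fp : R -> R) (p h : R) :
  1 <= p -> 0 < h ->
  mu.-integrable `]0, h[ (EFin \o (fun t => Fp t * (h - t) `^ (p - 1))) ->
  fracP F0 Fp p c @[c --> h^'-] --> fracP F0 Fp p h.
Proof.
move=> p1 h0 intF; have q0 : 0 <= p - 1 by lra.
set q := p - 1 in intF q0 *.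
rewrite /fracP -/q; apply: cvgD.
  by apply: cvgMr; apply: cvg_at_left_filter; exact: powR_continuous.
have mF : measurable_fun `]0, h[ Fp.
  by apply: (measurable_div_powR (q := q)); exact: measurable_integrable intF.
have mD : measurable (`]0, h[ : set R) by exact: measurable_itv.
apply/cvg_at_leftP => u [uh cu].
(* All integrals are moved to the fixed domain []0, h[]; the cut-off is explicit because [powR] does
   not vanish at negative bases. *)
pose fn (n : nat) t := Fp t * (if t < u n then (u n - t) `^ q else 0).
have fnE n : \int[mu]_(t in `]0, u n[) (Fp t * (u n - t) `^ q) = \int[mu]_(t in `]0, h[) fn n t.
  rewrite Rintegral_mkcond [RHS]Rintegral_mkcond; congr Rintegral; apply/funext => t.
  rewrite !patchE /fn; case: ifPn; rewrite ?inE ?notin_setE/= in_itv/= => tu.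
    case/andP: tu => t0 tu; rewrite mem_set/=; last by rewrite in_itv/= t0 (lt_trans tu).
    by rewrite tu.
  case: ifPn => //; rewrite inE/= in_itv/= => /andP[t0 th].
  by move: tu; rewrite t0/= => /negP/negbTE ->; rewrite mulr0.
rewrite (_ : (fun n => _) = (fun n => \int[mu]_(t in `]0, h[) fn n t)); last first.
  by apply/funext => n; exact: fnE.
apply: (@cvg_Rintegral_dominated _ _ _ _ (fun t => `|Fp t * (h - t) `^ q|)).
- exact: mD.
- move=> n; apply: measurable_funM; first exact: mF.
  apply: measurable_funTS; apply: measurable_fun_ifT.
  + exact: measurable_fun_ltr.
  + exact: (measurable_powRB _ _ _).2.
  + exact: measurable_cst.
- exact: measurable_integrable intF.
- move=> t /=; rewrite in_itv/= => /andP[t0 th].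
  rewrite /fn; apply: cvgMr.
  have ht : 0 < h - t by rewrite subr_gt0.
  have H : (u n - t) `^ q @[n --> \oo] --> (h - t) `^ q.
    apply: (@cvg_comp _ _ _ (fun n => u n - t) (fun z => z `^ q) _ (nbhs (h - t))).
      by apply: cvgB => //; exact: cvg_cst.
    exact: powR_continuous.
  apply: cvg_trans H; apply: near_eq_cvg; near=> n.
  rewrite ifT//; near: n; exact: (cvgr_gt h cu).
- exact: integrable_norm intF.
- move=> n t /=; rewrite in_itv/= => /andP[t0 th].
  rewrite /fn !normrM ler_wpM2l//; case: ifPn => tu; last by rewrite normr0.
  rewrite !ger0_norm ?powR_ge0// ge0_ler_powR ?nnegrE//.
  + by rewrite subr_ge0 ltW.
  + by rewrite subr_ge0 ltW.
  + by rewrite lerD2r ltW.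
Unshelve. all: by end_near. Qed.

(** A nonzero limit would keep [D] beyond [l / 2], on the side of the sign of [l], over some [[c,
    d[], whose integral is a difference of two zero integrals. This is the passage from equal
    primitives to equality at one point. *)
Lemma cvg_left_eq0 (R : realType) (D : R -> R) (l h : R) : 0 < h ->
  (forall d, 0 < d < h -> mu.-integrable `]0, d[ (EFin \o D)) ->
  (forall d, 0 < d < h -> \int[mu]_(c in `]0, d[) D c = 0) ->
  D c @[c --> h^'-] --> l -> l = 0.
Proof.
move=> h0 intD D0 Dl; apply/eqP/contraT => l0.
have l2 : 0 < `|l| / 2 by rewrite divr_gt0// normr_gt0.
have /cvgrPdist_lt/(_ _ l2) := Dl.
move=> /nbhs_ballP[r/= r0 Hr].
(* [[c, h[] lies in the ball of radius [r] around [h] and to the right of 0. *)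
pose c := Order.max (h / 2) (h - r / 2).
pose d := (c + h) / 2.
have ch : c < h by rewrite /c gt_max; apply/andP; split; lra.
have c0 : 0 < c by rewrite /c lt_max; apply/orP; left; lra.
have cr : h - r / 2 <= c by rewrite /c le_max lexx orbT.
have cd : c < d by rewrite /d; lra.
have dh : d < h by rewrite /d; lra.
have d0 : 0 < d by rewrite (lt_trans c0).
have c0h : 0 < c < h by rewrite c0.
have d0h : 0 < d < h by rewrite d0.
have icd : mu.-integrable `[c, d[ (EFin \o D).
  apply: integrableS (intD _ d0h); [exact: measurable_itv|exact: measurable_itv|].
  by apply: subset_itv; rewrite bnd_simp.
have Icd : \int[mu]_(t in `[c, d[) D t = 0.
  have := D0 _ d0h.
  have -> : `]0, d[%classic = `]0, c[%classic `|` `[c, d[%classic :> set R.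
    by rewrite -itv_bndbnd_setU// bnd_simp// ltW.
  rewrite Rintegral_setU.
  - by rewrite (D0 _ c0h) add0r.
  - exact: measurable_itv.
  - exact: measurable_itv.
  - have -> : `]0, c[%classic `|` `[c, d[%classic = `]0, d[%classic :> set R.
      by rewrite -itv_bndbnd_setU// bnd_simp// ltW.
    exact: intD.
  - by apply: lt_disjoint => s t; rewrite !in_itv/= => /andP[_ sc] /andP[ct _]; exact: lt_le_trans ct.
have mcd : measurable (`[c, d[ : set R) by exact: measurable_itv.
have mucd : (lebesgue_measure (`[c, d[%classic : set R) = (d - c)%:E)%E.
  by rewrite lebesgue_measure_itv/= lte_fin cd.
have icst (k : R) : mu.-integrable `[c, d[ (EFin \o cst k).
  apply: measurable_bounded_integrable => //; last exact: bounded_cst.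
  by rewrite [X in (X < _)%E]mucd ltry.
have Icst (k : R) : \int[mu]_(t in `[c, d[) k = k * (d - c).
  by rewrite Rintegral_cst// [X in fine X]mucd.
have near_l t : c <= t < d -> `|l - D t| < `|l| / 2.
  move=> /andP[ct td]; apply: Hr; last by rewrite /=; lra.
  by rewrite /ball/= ger0_norm; lra.
have [l_pos|l_neg] : 0 < l \/ l < 0 by move: l0; rewrite neq_lt => /orP[|]; [right|left].
- have : \int[mu]_(t in `[c, d[) (l / 2) <= \int[mu]_(t in `[c, d[) D t.
    apply: le_Rintegral => //; first exact: icst.
    move=> t; rewrite /= in_itv/= => /near_l; rewrite (gtr0_norm l_pos) ltr_norml => /andP[]; lra.
  rewrite Icd Icst leNgt mulr_gt0//; [by lra|by rewrite subr_gt0].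
- have : \int[mu]_(t in `[c, d[) D t <= \int[mu]_(t in `[c, d[) (l / 2).
    apply: le_Rintegral => //; first exact: icst.
    move=> t; rewrite /= in_itv/= => /near_l; rewrite (ltr0_norm l_neg) ltr_norml => /andP[]; lra.
  rewrite Icd Icst => H.
  have : 0 < (- l / 2) * (d - c) by rewrite mulr_gt0 ?subr_gt0//; lra.
  lra.
Qed.

(** On []0, d[] the weight is at least [(h - d) ^ p > 0], so it can be divided out. *)
Lemma integrable_div_powR (R : realType) (Fp : R -> R) (p h d : R) : 0 <= p -> d < h ->
  mu.-integrable `]0, h[ (EFin \o (fun t => Fp t * (h - t) `^ p)) ->
  mu.-integrable `]0, d[ (EFin \o Fp).
Proof.
move=> p0 dh intF.
have intd := integrable_sub_itv (lexx 0) (ltW dh) intF.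
have mD : measurable (`]0, d[ : set R) by exact: measurable_itv.
have hd : 0 < h - d by rewrite subr_gt0.
apply: (@integrable_eq _ _ (fun t => Fp t * (h - t) `^ p * (h - t) `^ (- p))) => //.
  move=> t /=; rewrite in_itv/= => /andP[t0 td].
  have ht : 0 < h - t by lra.
  by rewrite powRN mulfK// gt_eqF// powR_gt0.
apply: (@integrableMl_bounded _ _ _ _ ((h - d) `^ (- p))) => //.
  exact: (measurable_powRB _ _ _).2.
move=> t /=; rewrite in_itv/= => /andP[t0 td].
rewrite ger0_norm ?powR_ge0// !powRN lef_pV2 ?posrE ?powR_gt0//; last by lra.
by rewrite ge0_ler_powR ?nnegrE//; lra.
Qed.

Lemma integrable_mul_powR_inv (R : realType) (w : R -> R) (p c : R) : p <= 0 ->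
  mu.-integrable `]0, c[ (EFin \o (fun u => w u * (c - u) `^ p)) ->
  mu.-integrable `]0, c[ (EFin \o w).
Proof.
move=> p0 intw.
have mD : measurable (`]0, c[ : set R) by exact: measurable_itv.
apply: (@integrable_eq _ _ (fun t => w t * (c - t) `^ p * (c - t) `^ (- p))) => //.
  move=> t /=; rewrite in_itv/= => /andP[t0 td].
  have ht : 0 < c - t by lra.
  by rewrite powRN mulfK// gt_eqF// powR_gt0.
by apply: integrable_mul_powR => //; rewrite oppr_ge0.
Qed.

(** Convolution with exponent [be - 1] yields [Gamma al * Gamma be] times the primitive of [w] on
    one side, and the same factor times [fracP] of order [q + 2] over [Gamma (q + 2)] on the other.
    The latter is the primitive of [Psi], by [fracP_conv] with [b = 1]. *)
Lemma abel_inversion (R : realType) (n : nat) (q h F0 L : R) (w Fp : R -> R) :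
  0 < q -> 0 < n%:R - q < 1 -> 0 < h ->
  (forall c, 0 < c < h ->
    mu.-integrable `]0, c[ (EFin \o (fun u => w u * (c - u) `^ (n%:R - q - 1)))) ->
  (forall c, 0 < c < h ->
    \int[mu]_(u in `]0, c[) (w u * (c - u) `^ (n%:R - q - 1)) =
    Gamma (n%:R - q) / n`!%:R * fracP F0 Fp (n%:R + 1) c) ->
  mu.-integrable `]0, h[ (EFin \o (fun t => Fp t * (h - t) `^ q)) ->
  w c @[c --> h^'-] --> L ->
  L = fracP F0 Fp (q + 1) h / Gamma (q + 1).
Proof.
move=> q0 /andP[al0 al1] h0 intw Jw intF wL.
set al := n%:R - q in al0 al1 intw Jw *.
(* The complementary exponent: [al + be = 1] makes the composed kernel on [w] constant, and the
   order [n + 1] becomes [n + 1 + be = q + 2]. *)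
pose be := 1 - al.
have be0 : 0 < be by rewrite /be subr_gt0.
have albe : al + be = 1 by rewrite /be; ring.
have n1be : n%:R + 1 + be = q + 2 by rewrite /be /al; ring.
have G q' : 0 < q' -> Gamma q' != 0 :> R by move=> /Gamma_gt0/gt_eqF ->.
have nf : n`!%:R != 0 :> R by rewrite pnatr_eq0 -lt0n fact_gt0.
have intFd d : 0 < d < h -> mu.-integrable `]0, d[ (EFin \o Fp).
  by move=> /andP[d0 dh]; apply: integrable_div_powR dh intF; exact: ltW.
have intwd d : 0 < d < h -> mu.-integrable `]0, d[ (EFin \o w).
  move=> /andP[d0 dh]; apply: (@integrable_sub_itv _ w 0 d 0 ((d + h) / 2)) => //; first by lra.
  by apply: (integrable_mul_powR_inv _ (intw _ _)); lra.
pose Psi c := fracP F0 Fp (q + 1) c / Gamma (q + 1).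
have intPsi d : 0 < d < h -> mu.-integrable `]0, d[ (EFin \o Psi) /\
    \int[mu]_(c in `]0, d[) Psi c = fracP F0 Fp (q + 2) d / Gamma (q + 2).
  move=> dh; have mD : measurable (`]0, d[ : set R) by exact: measurable_itv.
  have d0 : 0 < d by case/andP: dh.
  have q1 : 1 <= q + 1 by lra.
  have [i1 e1] := @fracP_conv R F0 Fp (q + 1) 1 d q1 ltr01 d0 (intFd _ dh).
  have E : (fun c => (d - c) `^ (1 - 1) * fracP F0 Fp (q + 1) c) = fracP F0 Fp (q + 1).
    by apply/funext => c; rewrite subrr powRr0 mul1r.
  rewrite E in i1 e1.
  have PsiE : Psi = (fun c => (Gamma (q + 1))^-1 * fracP F0 Fp (q + 1) c).
    by apply/funext => c; exact: mulrC.
  rewrite PsiE; split; first exact: integrableZ_EFin.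
  rewrite (Rintegral_scale _ mD i1) e1 Gamma1 mulr1.
  have -> : q + 1 + 1 = q + 2 by ring.
  by rewrite !mulrA mulVf ?mul1r ?G ?(mulrC (_^-1))//; lra.
have intw_eq d : 0 < d < h -> \int[mu]_(c in `]0, d[) w c = fracP F0 Fp (q + 2) d / Gamma (q + 2).
  move=> dh; have mD : measurable (`]0, d[ : set R) by exact: measurable_itv.
  have d0 : 0 < d by case/andP: dh.
  have intwc c : 0 < c < d -> mu.-integrable `]0, c[ (EFin \o (fun u => w u * (c - u) `^ (al - 1))).
    by move=> /andP[c0 cd]; apply: intw; rewrite c0 (lt_trans cd)//; case/andP: dh.
  have albe1 : 1 <= al + be by rewrite albe.
  have [i1 e1] := abel_fubini al0 be0 albe1 d0 (intwd _ dh) intwc.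
  have n1 : 1 <= n%:R + 1 :> R by rewrite lerDr.
  have [i2 e2] := @fracP_conv R F0 Fp (n%:R + 1) be d n1 be0 d0 (intFd _ dh).
  have E1 : \int[mu]_(u in `]0, d[) (w u * (d - u) `^ (al + be - 1)) = \int[mu]_(u in `]0, d[) w u.
    by apply: eq_Rintegral => u _; rewrite albe subrr powRr0 mulr1.
  have E2 : \int[mu]_(c in `]0, d[) ((d - c) `^ (be - 1) *
      \int[mu]_(u in `]0, c[) (w u * (c - u) `^ (al - 1))) =
      \int[mu]_(c in `]0, d[) (Gamma al / n`!%:R * ((d - c) `^ (be - 1) * fracP F0 Fp (n%:R + 1) c)).
    apply: eq_Rintegral => c; rewrite inE/= in_itv/= => /andP[c0 cd].
    rewrite Jw; first by rewrite mulrCA.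
    by rewrite c0 (lt_trans cd)//; case/andP: dh.
  move: e1; rewrite /= E1 E2 (Rintegral_scale _ mD i2) e2 albe Gamma1 divr1 n1be Gamma_nat => e1.
  have Gal := G _ al0; have Gbe := G _ be0.
  apply: (mulfI (mulf_neq0 Gal Gbe)); rewrite -e1.
  have Gq2 : Gamma (q + 2) != 0 :> R by apply: G; exact: addr_gt0.
  move: nf Gq2 {e1}; move: (Gamma al) (Gamma be) (Gamma (q + 2)) (fracP _ _ _ _) => A B C P nf Gq2.
  by field; rewrite nf Gq2.
suff : L - fracP F0 Fp (q + 1) h / Gamma (q + 1) = 0 by move=> /eqP; rewrite subr_eq0 => /eqP.
apply: (@cvg_left_eq0 _ (fun c => w c + -1 * Psi c) _ h h0).
- move=> d dh; apply: integrableD_EFin; [exact: measurable_itv|exact: intwd|].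
  by apply: integrableZ_EFin; [exact: measurable_itv|exact: (intPsi _ dh).1].
- move=> d dh; have mD : measurable (`]0, d[ : set R) by exact: measurable_itv.
  have iP := integrableZ_EFin (-1) mD (intPsi _ dh).1.
  have iw := intwd _ dh.
  have -> : \int[mu]_(c in `]0, d[) (w c + -1 * Psi c) =
    \int[mu]_(c in `]0, d[) w c + \int[mu]_(c in `]0, d[) (-1 * Psi c).
    by move: iw iP mD; clear; move=> ? ? ?; rewrite RintegralD.
  rewrite (Rintegral_scale _ mD (intPsi _ dh).1) (intPsi _ dh).2 intw_eq//.
  by rewrite mulN1r subrr.
- have -> : (fun c => w c + -1 * Psi c) = (fun c => w c - Psi c).
    by apply/funext => c; rewrite mulN1r.
  apply: cvgB => //; apply: cvgMl; apply: fracP_cvg_left => //; first by lra.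
  by rewrite addrK.
Qed.

Lemma cvg_at_left_shift (R : realType) (f : R -> R) (y h l : R) :
  f z @[z --> (h + y)^'-] --> l -> f (u + y) @[u --> h^'-] --> l.
Proof.
move=> /cvg_at_leftP H; apply/cvg_at_leftP => u [uh cu].
apply: (H (fun n => u n + y)); split => [n|]; first by rewrite ltrD2r.
by apply: cvgD => //; exact: cvg_cst.
Qed.

Lemma cvg_at_right_shift (R : realType) (f : R -> R) (y h l : R) :
  f z @[z --> (h + y)^'+] --> l -> f (u + y) @[u --> h^'+] --> l.
Proof.
move=> /cvg_at_rightP H; apply/cvg_at_rightP => u [uh cu].
apply: (H (fun n => u n + y)); split => [n|]; first by rewrite ltrD2r.
by apply: cvgD => //; exact: cvg_cst.
Qed.

Lemma measurable_shift_itv (R : realType) (f : R -> R) (y a b : R) :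
  measurable_fun `]a + y, b + y[ f -> measurable_fun `]a, b[ (fun s => f (s + y)).
Proof.
move=> mf.
have mD : measurable (`]a + y, b + y[ : set R) by exact: measurable_itv.
have mf' : measurable_fun [set: R] (f \_ `]a + y, b + y[) by exact/(measurable_restrictT f mD).
have mg : measurable_fun `]a, b[ (fun s : R => s + y) by exact: measurable_funD.
have := measurableT_comp mf' mg; apply: eq_measurable_fun => s.
rewrite inE/= in_itv/= => sab.
by rewrite /= patchE mem_set//= in_itv/= !ltrD2r.
Qed.

Lemma integrable_shift_itv (R : realType) (f : R -> R) (y a b : R) :
  mu.-integrable `]a + y, b + y[ (EFin \o f) ->
  mu.-integrable `]a, b[ (EFin \o (fun s => f (s + y))).
Proof.
move=> intf; have mf := measurable_integrable intf.
apply/integrableP; split; first by apply/measurable_EFinP; exact: measurable_shift_itv.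
case/integrableP: intf => _; apply: le_lt_trans.
rewrite (@integral_shift _ y _ (fun x => `|f x|)); last 2 first.
- exact: measurable_itv.
- exact: measurableT_comp.
have -> : (fun s => s + y) @^-1` `]a + y, b + y[ = `]a, b[%classic :> set R.
  by apply/seteqP; split => x /=; rewrite !in_itv/= !ltrD2r.
exact: lexx.
Qed.

(** The factor [C] is [1 / Gamma (n - q)], or 1 when [q] is an integer, so that both cases share
    this expansion. The convergence of [lf] bounds the top derivative near [0+], which together with
    the order of vanishing of [C * J] yields zero initial values. *)
Lemma iterated_primitive_expansion (R : realType) (N : nat) (y h C F0 : R) (J lf : R -> R) :
  (forall t, 0 < t < h -> nderivable N.+1 J (y + t)) ->
  (forall t, 0 < t -> lf t = C * derive1n N.+1 J (y + t)) ->
  (forall t, 0 < t < h -> derivable lf t 1) ->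
  lf t @[t --> 0^'+] --> F0 ->
  little0 N (fun t => C * J (y + t)) ->
  forall c, 0 < c < h -> mu.-integrable `]0, c[ (EFin \o derive1 lf) ->
  C * J (y + c) = (N.+1)`!%:R^-1 * fracP F0 (derive1 lf) (N.+1%:R + 1) c.
Proof.
move=> dJ lfE dlf lfF J0 c ch intF.
(* The chain is continued past order [N + 1] by [derive1 lf], so that the hypotheses on [lf] apply
   as they stand; [lf] agrees with the derivative of [J] only for [t > 0]. *)
pose u k t := if (k <= N.+1)%N then C * derive1n k J (y + t) else derive1 lf t.
have h0 : 0 < h by case/andP: ch => ? ?; lra.
have ndJ m k z : (k < m)%N -> nderivable m J z -> derivable (derive1n k J) z 1.
  elim: m => [//|m IH]; rewrite ltnS leq_eqVlt => /predU1P[->|km] /= [nd dm] //.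
  by apply: IH => //; exact: nbhs_singleton nd.
have du k t : (k <= N.+1)%N -> 0 < t < h -> is_derive t 1 (u k) (u k.+1 t).
  move=> kN th; move: (kN); rewrite leq_eqVlt => /predU1P[kE|kN'].
    subst k; rewrite /u leqnn ltnn.
    have dl := dlf _ th.
    have : is_derive t 1 lf (derive1 lf t) by rewrite derive1E; exact: derivableP.
    apply: is_derive_near_eq; near=> s; apply: lfE.
    by near: s; apply: lt_nbhsr; case/andP: th.
  rewrite /u kN kN'.
  have dk : derivable (derive1n k J) (y + t) 1 by apply: (ndJ N.+1) => //; exact: dJ.
  have d1 : is_derive (y + t) 1 (derive1n k J) (derive1n k.+1 J (y + t)).
    by rewrite derive1nS derive1E; exact: derivableP.
  have d2 : is_derive t 1 (fun s => y + s) 1.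
    by rewrite -[X in is_derive _ _ _ X]add0r; apply: is_deriveD.
  have := is_deriveZ C (is_derive1_comp d1 d2).
  by rewrite mulr1.
have near_h (P : R -> Prop) : (forall t, 0 < t < h -> P t) -> \forall t \near (0 : R)^'+, P t.
  move=> HP; near=> t; apply: HP; apply/andP; split; near: t.
    exact: nbhs_right_gt.
  exact: nbhs_right_lt.
have un : u N.+1 t @[t --> 0^'+] --> F0.
  apply: cvg_trans lfF; apply: near_eq_cvg; apply: near_h => t /andP[t0 _].
  by rewrite /u leqnn lfE.
have uk k : (k < N.+1)%N -> u k t @[t --> 0^'+] --> 0.
  rewrite ltnS; apply: (@little0_cvg_derivatives _ N u (`|F0| + 1)).
  - by move=> j jN; apply: near_h => t; apply: du; exact: leqW.
  - have /cvgr_le : `|u N.+1 t| @[t --> 0^'+] --> `|F0| by exact: cvg_norm.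
    by apply; rewrite ltrDl.
  - exact: J0.
have uE : u N.+2 = derive1 lf by apply/funext => t; rewrite /u ltnn.
have := @taylor_integral_remainder R N.+1 u F0 c h ch du uk un.
rewrite uE => /(_ intF); rewrite {1}/u/= => ->.
have c0 : 0 < c by case/andP: ch.
rewrite /fracP addrK mulrDr powR_mulrn ?(ltW c0)//; congr (_ + _); first by ring.
have mD : measurable (`]0, c[ : set R) by exact: measurable_itv.
have intFc : mu.-integrable `]0, c[ (EFin \o (fun t => derive1 lf t * (c - t) `^ N.+1%:R)).
  exact: integrable_mul_powR.
rewrite -(Rintegral_scale _ mD intFc); apply: eq_Rintegral => t.
rewrite inE/= in_itv/= => /andP[t0 tc].
rewrite powR_mulrn; last by rewrite subr_ge0 ltW.
by rewrite mulrA mulrC.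
Unshelve. all: by end_near. Qed.

(** * The Taylor polynomial of a one-sided derivative *)

Lemma cvg_at_right_shift0 (R : realType) (f : R -> R) (y l : R) :
  f z @[z --> y^'+] --> l -> f (u + y) @[u --> 0^'+] --> l.
Proof. by move=> H; apply: cvg_at_right_shift; rewrite add0r. Qed.

Lemma is_derive_cvg (R : realType) (f : R -> R) (z l : R) :
  (f x - f z) / (x - z) @[x --> z^'] --> l -> is_derive z 1 f l.
Proof.
move=> fl.
have H : h^-1 *: (f (h *: 1 + z) - f z) @[h --> 0^'] --> l.
  apply/cvgrPdist_lt => e e0; have /cvgrPdist_lt/(_ _ e0) := fl.
  move=> /nbhs_ballP[r/= r0 Hr]; apply/nbhs_ballP; exists r => //= h hr h0.
  have := Hr (h + z); rewrite /ball/= opprD addrCA subrr addr0 addrK normrN => /(_ _ _)H.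
  have -> : h^-1 *: (f (h *: 1 + z) - f z) = (f (h + z) - f z) / h.
    by rewrite /GRing.scale/= mulr1 mulrC.
  apply: H; first by move: hr; rewrite /ball/= sub0r normrN.
  by rewrite -subr_eq0 addrK.
split; first exact: (cvgP l H).
exact: cvg_lim H.
Qed.

Lemma within_dnbhs (R : realType) (D : set R) (z : R) : nbhs z D -> within D z^' = z^'.
Proof.
move=> zD; apply/seteqP; split => P; rewrite /within /dnbhs/=.
  by apply: filterS2 zD => x Dx H xz; exact: H.
by apply: filterS => x H _.
Qed.

Lemma is_derive_within (R : realType) (D : set R) (f : R -> R) (z : R) : nbhs z D ->
  derivable_within D f z -> is_derive z 1 f (derive_within D f z).
Proof.
move=> zD; rewrite /derivable_within /derive_within (within_dnbhs zD) => cf.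
exact: is_derive_cvg.
Qed.

Lemma derive_within_right (R : realType) (f : R -> R) (y : R) : 0 <= y < 1 ->
  derivable_within `[0, 1] f y ->
  (f x - f y) / (x - y) @[x --> y^'+] --> derive_within `[0, 1] f y.
Proof.
move=> /andP[y0 y1] df; apply: cvg_trans df.
move=> P; rewrite /nbhs/= /within/= /dnbhs /at_right /within/= => H.
have H1 : \forall x \near y, x < 1 by exact: lt_nbhsl.
apply: filterS2 H1 H => x x1 H yx; apply: H; first by rewrite gt_eqF.
by rewrite in_itv/= ltW ?(le_lt_trans y0 yx)//= ltW.
Qed.

Lemma cvg_right_derivable_within (R : realType) (f : R -> R) (y : R) : 0 <= y < 1 ->
  derivable_within `[0, 1] f y -> f x @[x --> y^'+] --> f y.
Proof.
move=> y01 df; have dl := derive_within_right y01 df.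
have xy : x - y @[x --> y^'+] --> y - y.
  by apply: cvgB; [exact: cvg_at_right_filter|exact: cvg_cst].
have cy : (cst (f y)) x @[x --> y^'+] --> f y by exact: cvg_cst.
have : (f x - f y) / (x - y) * (x - y) + f y @[x --> y^'+] -->
    derive_within `[0, 1] f y * (y - y) + f y.
  by apply: cvgD => //; exact: cvgM.
rewrite subrr mulr0 add0r; apply: cvg_trans; apply: near_eq_cvg; near=> x.
have yx : y < x by near: x; exact: nbhs_right_gt.
by rewrite /= divfK ?subrK// subr_eq0 gt_eqF.
Unshelve. all: by end_near. Qed.

Lemma nderivable_withinS (R : realType) (D : set R) (m k : nat) (f : R -> R) (z : R) :
  D z -> (k < m)%N -> nderivable_within D m f z ->
  nderivable_within D k f z /\ derivable_within D (nderive_within D k f) z.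
Proof.
move=> Dz; elim: m => [//|m IH]; rewrite ltnS => km [near_m dm].
have nm : nderivable_within D m f z.
  by have := nbhs_singleton near_m; exact.
move: km; rewrite leq_eqVlt => /predU1P[->|km]; first by split.
exact: IH.
Qed.

Lemma is_derive_taylor_sum (R : realType) (a : nat -> R) (m : nat) (t : R) :
  is_derive t 1 (fun s => \sum_(k < m.+1) a k / k`!%:R * s ^+ k)
    (\sum_(k < m) a k.+1 / k`!%:R * t ^+ k).
Proof.
elim: m => [|m IH].
  rewrite big_ord0 (_ : (fun s => _) = cst (a 0%N)); first exact: is_derive_cst.
  by apply/funext => s; rewrite big_ord1 fact0 divr1 expr0 mulr1.
rewrite (_ : (fun s => _) = (fun s => \sum_(k < m.+1) a k / k`!%:R * s ^+ k) +
    (a m.+1 / (m.+1)`!%:R \*: (@id R ^+ m.+1))); last first.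
  by apply/funext => s; rewrite big_ord_recr/= exprfctE.
rewrite big_ord_recr/=.
have d1 : is_derive t 1 (a m.+1 / (m.+1)`!%:R \*: (@id R ^+ m.+1))
    (a m.+1 / (m.+1)`!%:R *: ((m.+1%:R * t ^+ m) *: 1)).
  by apply: is_deriveZ; exact: is_deriveX.
have := is_deriveD IH d1.
rewrite (_ : _ *: _ = a m.+1 / m`!%:R * t ^+ m)// /GRing.scale/= mulr1 factS natrM.
have n1 : m.+1%:R != 0 :> R by rewrite pnatr_eq0.
have nf : m`!%:R != 0 :> R by rewrite pnatr_eq0 -lt0n fact_gt0.
by field; rewrite nf addrC natr1 n1.
Qed.

(** The [N]-th derivative may exist at [y] alone, so it is used only through the difference quotient
    of the one below, which gives order [o(t)]; each integration then gains a power. For [N = 0] the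
    claim is right-continuity. *)
Lemma taylor_peano_right (R : realType) (f : R -> R) (y : R) (N : nat) :
  0 <= y < 1 -> nderivable_within `[0, 1] N f y -> f z @[z --> y^'+] --> f y ->
  little0 N (fun t => f (y + t) -
    \sum_(k < N.+1) nderive_within `[0, 1] k f y / k`!%:R * t ^+ k).
Proof.
move=> y01 nd fy; set a := fun k => nderive_within `[0, 1] k f y.
have [y0 y1] : 0 <= y /\ y < 1 by apply/andP.
have Dy : `[0, 1]%classic y by rewrite /= in_itv/= y0 ltW.
case: N nd => [_|N nd].
  have H : (f (t + y) @[t --> 0^'+] --> f y) by apply: cvg_at_right_shift; rewrite add0r.
  move/little0_cvg: H => H e e0; have := H _ e0; apply: filterS => t.
  by rewrite big_ord1/= fact0 divr1 expr0 !mulr1 (addrC t).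
(* The [j]-th derivative of the remainder. After the case split [N] is one less than in the
   statement, so the polynomial has [N + 2 - j] terms. *)
pose v j t := nderive_within `[0, 1] j f (y + t) -
  \sum_(k < N.+2 - j) a (j + k)%N / k`!%:R * t ^+ k.
have dfj j : (j <= N)%N -> derivable_within `[0, 1] (nderive_within `[0, 1] j f) y.
  by move=> jN; have [] := nderivable_withinS Dy (jN : (j < N.+1)%N) nd.
have cT j : (\sum_(k < N.+2 - j) a (j + k)%N / k`!%:R * t ^+ k) @[t --> 0^'+] -->
    (\sum_(k < N.+2 - j) a (j + k)%N / k`!%:R * 0 ^+ k).
  apply: cvg_big => [|k _]; first exact: add_continuous.
  by apply: cvgMr; apply: cvg_at_right_filter; exact: exprn_continuous.
have T0 j : (j <= N)%N -> \sum_(k < N.+2 - j) a (j + k)%N / k`!%:R * 0 ^+ k = a j.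
  move=> jN; rewrite subSn ?leqW// big_ord_recl/= big1; last first.
    by move=> k _; rewrite exprS mul0r mulr0.
  by rewrite addr0 addn0 fact0 divr1 expr0 mulr1.
have v0 j : (j <= N)%N -> v j t @[t --> 0^'+] --> 0.
  move=> jN; have cTj := cT j; rewrite (T0 _ jN) in cTj.
  have := cvg_right_derivable_within y01 (dfj _ jN).
  move=> /cvg_at_right_shift0 fj.
  have H : v j t @[t --> 0^'+] --> a j - a j.
    apply: cvgB => //.
    rewrite (_ : (fun t => _) = (fun t => nderive_within `[0, 1] j f (t + y)))//.
    by apply/funext => t; rewrite addrC.
  by rewrite subrr in H.
have key i : (i <= N)%N -> little0 i.+1 (v (N - i)%N).
  elim: i => [_|i IH iN].
    rewrite subn0 => e e0.
    have := derive_within_right y01 (dfj _ (leqnn N)).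
    move=> /cvg_at_right_shift0/cvgrPdist_le/(_ _ e0) H.
    near=> t; have t0 : 0 < t by near: t; exact: nbhs_right_gt.
    rewrite /v subSn// subSnn big_ord_recl big_ord1/= addn0 fact0 divr1 !expr1 expr0 mulr1.
    rewrite /bump/= add1n addn1 !factS fact0 muln1 divr1.
    have : `|a N.+1 - (nderive_within `[0, 1] N f (t + y) - nderive_within `[0, 1] N f y) / (t + y - y)| <= e.
      by near: t; exact: H.
    rewrite addrK -(ler_pM2r t0) -[X in _ * X <= _](gtr0_norm t0) -normrM mulrBl divfK ?gt_eqF//.
    by rewrite distrC opprD addrA (addrC t y).
  have e : (N - i = (N - i.+1).+1)%N by rewrite -subSn.
  set j := (N - i.+1)%N in e *.
  apply: (@little0_primitive _ _ _ (v j.+1)); last by rewrite -e; apply: IH; exact: ltnW.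
  - have [/= near_nd _] := nd.
    have H2 : \forall z \near y^'+, `[0, 1]%classic z -> nderivable_within `[0, 1] N f z.
      move: near_nd; rewrite /at_right /prop_near1 /nbhs/= /within/=.
      by apply: filterS => s H _; exact: H.
    have H0 : \forall z \near y^'+, nderivable_within `[0, 1] N f z /\ y < z < 1.
      near=> z; have yz : y < z by near: z; exact: nbhs_right_gt.
      have z1 : z < 1 by near: z; exact: nbhs_right_lt.
      split; last by rewrite yz.
      have : `[0, 1]%classic z by rewrite /= in_itv/=; lra.
      by near: z; exact: H2.
    move: H0 => /nbhs_ballP[r/= r0 Hr].
    near=> t; have t0 : 0 < t by near: t; exact: nbhs_right_gt.
    have tr : t < r by near: t; exact: nbhs_right_lt.
    have tball : ball y r (y + t) by rewrite /ball/= opprD addNKr normrN gtr0_norm.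
    have yt : y < y + t by rewrite ltrDl.
    have [ndz /andP[_ z1]] := Hr _ tball yt.
    have zD : `[0, 1]%classic (y + t) by rewrite /= in_itv/=; lra.
    (* Since [y < y + t < 1], the point is interior to [[0, 1]], where the derivative within the
       interval is the two-sided one. *)
    have zn : nbhs (y + t) (`[0, 1]%classic : set R).
      have : nbhs (y + t) (`]0, 1[%classic : set R).
        apply: open_nbhs_nbhs; split; first exact: itv_open.
        by rewrite /= in_itv/=; lra.
      by apply: filterS => s; rewrite /= !in_itv/= => /andP[/ltW -> /ltW ->].
    have jN : (j < N)%N by rewrite /j ltn_subrL/= (leq_ltn_trans _ iN).
    have [_ dz] := nderivable_withinS zD jN ndz.
    have d1 := is_derive_within zn dz.
    have d2 : is_derive t 1 (fun s => y + s) 1.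
      by rewrite -[X in is_derive _ _ _ X]add0r; apply: is_deriveD.
    have d3 := is_derive1_comp d1 d2.
    have d4 := @is_derive_taylor_sum R (fun k => a (j + k)%N) (N.+1 - j)%N t.
    have := is_deriveB d3 d4.
    rewrite mulr1 -subSn ?(leqW (ltnW jN))//.
    rewrite (_ : \sum_(k < N.+1 - j) a (j + k.+1)%N / k`!%:R * t ^+ k =
      \sum_(k < N.+2 - j.+1) a (j.+1 + k)%N / k`!%:R * t ^+ k)//.
    by rewrite subSS; apply: eq_bigr => k _; rewrite addnS addSn.
  - by apply: v0; rewrite /j leq_subr.
have := key N (leqnn N); rewrite subnn => H e e0; have := H e e0.
by apply: filterS => t; rewrite /v subn0.
Unshelve. all: by end_near. Qed.

(** * The local fractional expansion *)

Lemma normr_Rintegral_le (R : realType) (D : set R) (f g : R -> R) : measurable D ->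
  mu.-integrable D (EFin \o f) -> mu.-integrable D (EFin \o g) ->
  (forall x, D x -> `|f x| <= g x) ->
  `|\int[mu]_(x in D) f x| <= \int[mu]_(x in D) g x.
Proof.
move=> mD intf intg fg; apply: (@le_trans _ _ (\int[mu]_(x in D) `|f x|)).
  by apply: le_normr_Rintegral.
by apply: le_Rintegral => //; exact: integrable_norm intf.
Qed.

Lemma rl_order_eq (R : realType) (N : nat) (q : R) : N%:R < q <= N%:R + 1 -> rl_order q = N.+1.
Proof.
move=> /andP[Nq qN]; rewrite /rl_order (@ceil_def _ _ N.+1%:Z)//.
by rewrite -[X in (X - 1)%:~R]natz -natr1 addrK natz -!pmulrn -natr1 Nq.
Qed.

Lemma rl_integral_shift (R : realType) (q y t : R) (g : R -> R) :
  mu.-integrable `]y, y + t[ (EFin \o rl_integrand q y g (y + t)) ->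
  let w u := g (u + y) in
  mu.-integrable `]0, t[ (EFin \o (fun u => w u * (t - u) `^ ((rl_order q)%:R - q - 1))) /\
  rl_integral q y g (y + t) =
    \int[mu]_(u in `]0, t[) (w u * (t - u) `^ ((rl_order q)%:R - q - 1)).
Proof.
move=> intg w; set k := rl_integrand q y g (y + t) in intg *.
have kE : (fun s => k (s + y)) = (fun u => w u * (t - u) `^ ((rl_order q)%:R - q - 1)).
  apply/funext => u; rewrite /k /rl_integrand /w -powRN; congr (_ * _ `^ _); ring.
have E1 : `]y, y + t[ = `]0 + y, t + y[ by rewrite add0r addrC.
have intg' : mu.-integrable `]0 + y, t + y[ (EFin \o k) by rewrite -E1.
split; first by rewrite -kE; exact: integrable_shift_itv.
rewrite /rl_integral -/k -kE E1; apply: Rintegral_shift_itv.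
exact: measurable_integrable intg'.
Qed.

(* A kernel of positive order [al] preserves the order of vanishing at [0]. *)
Lemma little0_conv_powR (R : realType) (N : nat) (al h : R) (w : R -> R) :
  0 < al -> 0 < h ->
  (forall c, 0 < c < h ->
    mu.-integrable `]0, c[ (EFin \o (fun u => w u * (c - u) `^ (al - 1)))) ->
  little0 N w ->
  little0 N (fun t => \int[mu]_(u in `]0, t[) (w u * (t - u) `^ (al - 1))).
Proof.
move=> al0 h0 intw w0 e e0.
(* [B] is the integral of the kernel over the unit interval, as a Beta value with first argument 1.
   On []0, t[] the kernel has mass [B * t ^ al], at most [B] for [t < 1], whence the tolerance
   [e / B] for [w]. *)
set B := Gamma 1 * Gamma al / Gamma (1 + al) : R.
have B0 : 0 < B by rewrite /B divr_gt0 ?mulr_gt0// Gamma_gt0// addr_gt0.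
have eB0 : 0 < e / B by rewrite divr_gt0.
have := w0 _ eB0 => /nbhs_ballP[r/= r0 Hr].
near=> t.
have t0 : 0 < t by near: t; exact: nbhs_right_gt.
have t1 : t < 1 by near: t; exact: nbhs_right_lt.
have th : t < h by near: t; exact: nbhs_right_lt.
have tr : t < r by near: t; exact: nbhs_right_lt.
have mD : measurable (`]0, t[ : set R) by exact: measurable_itv.
have t0h : 0 < t < h by rewrite t0.
pose b u := (u - 0) `^ (1 - 1) * (t - u) `^ (al - 1).
have ib : mu.-integrable `]0, t[ (EFin \o b) by exact: integrable_beta_itv.
have eb : \int[mu]_(u in `]0, t[) b u = (t - 0) `^ (1 + al - 1) * B.
  exact: Rintegral_beta_itv.
pose M := e / B * t ^+ N.
have M0 : 0 <= M by rewrite /M mulr_ge0 ?exprn_ge0// ltW.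
apply: (@le_trans _ _ (\int[mu]_(u in `]0, t[) (M * b u))).
  apply: normr_Rintegral_le => //.
  - exact: intw.
  - exact: integrableZ_EFin.
  - move=> u; rewrite /= in_itv/= => /andP[u0 ut].
    rewrite normrM (ger0_norm (powR_ge0 _ _)) /b subrr powRr0 mul1r ler_wpM2r ?powR_ge0//.
    apply: (@le_trans _ _ (e / B * u ^+ N)).
      by apply: Hr => //; rewrite /ball/= sub0r normrN gtr0_norm// (lt_trans ut).
    by rewrite /M ler_pM2l// lerXn2r ?nnegrE ?ltW.
rewrite (Rintegral_scale _ mD ib) eb subr0 /M.
have -> : e / B * t ^+ N * (t `^ (1 + al - 1) * B) = e * t ^+ N * t `^ (1 + al - 1).
  by field; rewrite gt_eqF.
have tN : 0 <= e * t ^+ N by rewrite mulr_ge0 ?exprn_ge0// ltW.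
have -> : 1 + al - 1 = al by ring.
rewrite ler_piMr//.
have := ger_powR (a := t); rewrite t0 (ltW t1) => /(_ isT 0 al (ltW al0)).
by rewrite powRr0.
Unshelve. all: by end_near. Qed.

Theorem mainTheorem4 (R : realType) (f : R -> R) (y : R) (N : nat) (q : R)
  (hy : 0 <= y < 1)
  (hN : nderivable_within `[0, 1] N f y)
  (hNmax : forall M : nat, nderivable_within `[0, 1] M f y -> (M <= N)%N)
  (hq : N%:R < q <= N%:R + 1)
  (hD : local_fderivable f y q N)
  (hfy : f z @[z --> y^'+] --> f y) :
  forall x : R, y < x <= 1 ->
    f z @[z --> x^'-] --> f x ->
    lf_remainder_exists f y q N x ->
    f x = \sum_(n < N.+1)
            nderive_within `[0, 1] n f y / Gamma (n%:R + 1) * (x - y) ^+ n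
          + local_fderive f y q N / Gamma (q + 1) * (x - y) `^ q
          + lf_remainder f y q N x.
Proof.
move=> x /andP[yx _] fx [lfx intr].
set h := x - y in intr *.
have h0 : 0 < h by rewrite /h subr_gt0.
have xE : x = h + y by rewrite /h subrK.
have rlq := rl_order_eq hq.
have [Nq qN] : N%:R < q /\ q <= N%:R + 1 by apply/andP.
have N0 : 0 <= N%:R :> R by [].
have q0 : 0 < q by lra.
set F0 := local_fderive f y q N.
set F := lf f y q N.
set Fp := derive1 F.
(* [lf] and [lf_pos] differ only at 0, which a limit at [0+] ignores. *)
have FF0 : F t @[t --> 0^'+] --> F0.
  have [_ cv] := hD; rewrite /F0 /local_fderive; apply: cvg_trans cv.
  apply: near_eq_cvg; near=> t; rewrite /F /lf gt_eqF//.
pose T := taylor_poly f y N.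
pose g z := f z - T z.
have TE t : T (y + t) = \sum_(k < N.+1) nderive_within `[0, 1] k f y / k`!%:R * t ^+ k.
  by apply: eq_bigr => k _; rewrite Gamma_nat addrAC subrr add0r.
have g_small : little0 N (fun t => g (y + t)).
  have := taylor_peano_right hy hN hfy.
  by rewrite (_ : (fun t => _) = (fun t => g (y + t)))//; apply/funext => t; rewrite /g TE.
have Th (z : R) : T t @[t --> z^'-] --> T z.
  apply: cvg_big => [|k _]; first exact: add_continuous.
  apply: cvgMr; apply: cvg_at_left_filter.
  apply: (@continuous_comp _ _ _ (fun s => s - y) (fun s => s ^+ k)).
    by apply: continuousB => //; exact: cst_continuous.
  exact: exprn_continuous.
pose w u := g (u + y).
have wL : w u @[u --> h^'-] --> g x.
  apply: cvg_at_left_shift; rewrite -xE; apply: cvgB => //; exact: Th.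
have intF : mu.-integrable `]0, h[ (EFin \o (fun t => Fp t * (h - t) `^ q)) by exact: intr.
have intFc c : 0 < c < h -> mu.-integrable `]0, c[ (EFin \o Fp).
  by move=> /andP[c0 ch]; apply: integrable_div_powR ch intF; exact: ltW.
have dF t : 0 < t < h -> derivable F t 1 by move=> th; have [] := lfx t th.
have q1 : 1 <= q + 1 by lra.
(* At order [q + 1], [fracP] is the fractional term plus the remainder, both multiplied by
   [Gamma (q + 1)]; the two cases below end in this one formula. *)
suff gx : g x = fracP F0 Fp (q + 1) h / Gamma (q + 1).
  have -> : f x = T x + g x by rewrite /g addrC subrK.
  have -> : T x = \sum_(n < N.+1) nderive_within `[0, 1] n f y / Gamma (n%:R + 1) * h ^+ n by [].
  rewrite -addrA; congr (_ + _); rewrite gx /fracP addrK /lf_remainder -/h.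
  rewrite (_ : \int[mu]_(t in `]0, h[) remainder_integrand f y q N x t =
    \int[mu]_(u in `]0, h[) (Fp u * (h - u) `^ q))//.
  by rewrite mulrDl mulrAC (mulrC (Gamma (q + 1))^-1).
have nf : (N.+1)`!%:R != 0 :> R by rewrite pnatr_eq0 -lt0n fact_gt0.
(* For integer [q] the expansion already concerns [g] itself: it holds on []0, h[], and uniqueness
   of the left limit carries it to [h]. *)
have [qE|qE] := eqVneq q N.+1%:R.
  have wE c : 0 < c < h -> w c = (N.+1)`!%:R^-1 * fracP F0 Fp (N.+1%:R + 1) c.
    move=> ch; rewrite /w addrC -[LHS]mul1r.
    apply: (@iterated_primitive_expansion R N y h 1 F0 g F).
    - move=> t th; have [] := lfx t th.
      by rewrite /lf_pos_exists /rl_derivable rlq qE eqxx.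
    - move=> t t0; rewrite /F /lf gt_eqF// /lf_pos /rl_derive rlq qE eqxx mul1r//.
    - exact: dF.
    - exact: FF0.
    - by rewrite (_ : (fun t => _) = (fun t => g (y + t)))//; apply/funext => t; rewrite mul1r.
    - exact: ch.
    - exact: intFc.
  have H1 : fracP F0 Fp (q + 1) c @[c --> h^'-] --> fracP F0 Fp (q + 1) h.
    by apply: fracP_cvg_left => //; rewrite addrK.
  have H2 : (N.+1)`!%:R^-1 * fracP F0 Fp (q + 1) c @[c --> h^'-] -->
      (N.+1)`!%:R^-1 * fracP F0 Fp (q + 1) h by exact: cvgMr.
  have H3 : w c @[c --> h^'-] --> (N.+1)`!%:R^-1 * fracP F0 Fp (q + 1) h.
    apply: cvg_trans H2; apply: near_eq_cvg; near=> c.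
    rewrite wE -?qE//; apply/andP; split; near: c.
      exact: nbhs_left_gt.
    exact: nbhs_left_lt.
  have -> : g x = (N.+1)`!%:R^-1 * fracP F0 Fp (q + 1) h by exact: cvg_unique wL H3.
  by rewrite [in Gamma (q + 1)]qE Gamma_nat mulrC.
have N1 : N.+1%:R = N%:R + 1 :> R by rewrite natr1.
have al : 0 < N.+1%:R - q < 1.
  have : q < N.+1%:R by rewrite lt_neqAle qE N1.
  by rewrite N1 => ?; apply/andP; split; lra.
have [al0 al1] := andP al.
have Gal : Gamma (N.+1%:R - q) != 0 :> R by rewrite gt_eqF// Gamma_gt0.
have qrl : (q == (rl_order q)%:R) = false by rewrite rlq; exact/negbTE.
have ex t : 0 < t < h -> rl_derivable q y g (y + t) by move=> th; have [] := lfx t th.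
have intw c : 0 < c < h ->
  mu.-integrable `]0, c[ (EFin \o (fun u => w u * (c - u) `^ (N.+1%:R - q - 1))) /\
  rl_integral q y g (y + c) = \int[mu]_(u in `]0, c[) (w u * (c - u) `^ (N.+1%:R - q - 1)).
  move=> ch; have := ex c ch; rewrite /rl_derivable qrl => -[near_int _].
  have := nbhs_singleton near_int => /rl_integral_shift.
  by rewrite rlq.
have Jw0 : little0 N (fun t => (Gamma (N.+1%:R - q))^-1 * rl_integral q y g (y + t)).
  have w0 : little0 N w.
    by rewrite (_ : w = (fun t => g (y + t)))//; apply/funext => t; rewrite /w addrC.
  have := little0_conv_powR al0 h0 (fun c ch => (intw c ch).1) w0 => H e e0.
  have G0 : 0 < Gamma (N.+1%:R - q) :> R by exact: Gamma_gt0.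
  (* The tolerance absorbs the normalisation [1 / Gamma (N + 1 - q)] of the fractional integral. *)
  have := H (e * Gamma (N.+1%:R - q)); rewrite mulr_gt0// => /(_ isT) H1.
  near=> t.
  have th : 0 < t < h.
    apply/andP; split; near: t; [exact: nbhs_right_gt|exact: nbhs_right_lt].
  rewrite (intw _ th).2 normrM gtr0_norm ?invr_gt0// mulrC ler_pdivrMr// mulrAC.
  by near: t; exact: H1.
apply: (@abel_inversion R N.+1 q h F0 (g x) w Fp) => //.
- by move=> c ch; exact: (intw c ch).1.
- move=> c ch; rewrite -(intw c ch).2.
  have : (Gamma (N.+1%:R - q))^-1 * rl_integral q y g (y + c) =
      (N.+1)`!%:R^-1 * fracP F0 Fp (N.+1%:R + 1) c.
    apply: (@iterated_primitive_expansion R N y h _ F0 (rl_integral q y g) F).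
    + move=> t th; have := ex t th; rewrite /rl_derivable qrl => -[_].
      by rewrite rlq.
    + by move=> t t0; rewrite /F /lf gt_eqF// /lf_pos /rl_derive qrl rlq.
    + exact: dF.
    + exact: FF0.
    + exact: Jw0.
    + exact: ch.
    + exact: intFc.
  move=> /(congr1 (fun z => Gamma (N.+1%:R - q) * z)); rewrite mulVKf// => ->.
  by rewrite mulrA.
Unshelve. all: by end_near. Qed.
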